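(* Let $(f_i)_{i=1}^\infty$ be a sequence of maps, each as in the setting below and each satisfying conditions (i) and (ii). Then the set of $x\in[0,1)$ such that for every $i\in\mathbb N$, every $m\in\mathbb N$ and every word $w$ of length $m$ over $\{0,\dots,g_{f_i}-1\}$, the sequence $\tau^{f_i}_w(x,n)/(n-m)$ does not converge as $n\to\infty$, has Hausdorff dimension $1$.
   Context: Setting: $f\colon[0,1)\to[0,1)$ and $g_f\ge 2$ is an integer such that $[0,1)$ is partitioned into $g_f$ half-open intervals $[a,b)$, enumerated as $[0],\dots,[g_f-1]$, such that on each of them $f$ is monotone and maps onto $[0,1)$, and $|f(x)-f(y)|\ge |x-y|$ for all $x,y$ in the same interval. For a word $x_1\dots x_n$ over $\{0,\dots,g_f-1\}$ the generation-$n$ cylinder is $C_{x_1\dots x_n}=\{x\in[0,1): f^{i-1}(x)\in[x_i],\ i=1,\dots,n\}$; $[0,1)$ is the generation-$0$ cylinder. It is assumed that $|C_{x_1\dots x_n}|\to 0$ as $n\to\infty$ for every $(x_i)\in\{0,\dots,g_f-1\}^{\mathbb N}$, so each $x\in[0,1)$ has a unique coding sequence $(x_i)_{i\ge1}$ (its $f$-expansion). Condition (i) (bounded distortion): there is $K_f>0$ such that for every cylinder $C_{x_1\dots x_n}$ (including $[0,1)$), $|(f^n)'(y)|/|(f^n)'(z)|<K_f$ for all $y,z\in C_{x_1\dots x_n}$; this implies $|C_{x_1\dots x_{n+1}}|/|C_{x_1\dots x_n}|>1/(g_fK_f)$ for all sequences and all $n$. Frequencies: for $m\in\mathbb N$ enumerate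 the $g_f^m$ words of length $m$ as $w_1,\dots,w_{g_f^m}$. For $x$ with $f$-expansion $(x_i)$ and $n>m$ let $\tau^f_w(x,n)=\#\{i\in\{1,\dots,n-m\}: x_i\dots x_{i+m-1}=w\}$. For $\bar p=(p_{w_1},\dots,p_{w_{g_f^m}})\in[0,1]^{g_f^m}$ with $\sum_j p_{w_j}=1$, let $G^{f,m}_{\bar p}=\{x: \tau^f_{w_j}(x,n)/(n-m)\to p_{w_j}\text{ as }n\to\infty\ \forall j\}$. Condition (ii): for each $m$ there is $\bar p$ with $\dim_H G^{f,m}_{\bar p}=1$, and for each word $w$ of length $m$ and each $\delta>0$ there is $\bar q$ with $q_w\ne p_w$ and $\dim_H G^{f,m}_{\bar q}>1-\delta$. *)

(* Defs.v *)
From Stdlib Require Import Reals Lra Lia List.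
Import ListNotations.
Open Scope R_scope.

(* [Hnull s E]: the s-dimensional Hausdorff measure of E is zero, i.e. for
   every eps > 0 there is a countable cover (U_i) of E with
   sum_i diam(U_i)^s <= eps.  Diameters are bounded by positive reals r_i
   (this avoids the convention 0^s; sets of diameter 0 can always be given
   an arbitrarily small positive radius). *)
Definition Hnull (s : R) (E : R -> Prop) : Prop :=
  forall eps, 0 < eps ->
    exists (U : nat -> R -> Prop) (r : nat -> R),
      (forall x, E x -> exists i, U i x) /\
      (forall i, 0 < r i /\ forall x y, U i x -> U i y -> Rabs (x - y) <= r i) /\
      (forall N, sum_f_R0 (fun i => Rpower (r i) s) N <= eps).

Definition is_hdim (E : R -> Prop) (d : R) : Prop :=
  (forall s, 0 < s -> Hnull s E -> d <= s) /\
  (forall t, (forall s, 0 < s -> Hnull s E -> t <= s) -> t <= d).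

(* A map f together with g_f and the partition intervals [k] = [lo k, hi k),
   k = 0 .. g-1. *)
Record PMap := {
  pf : R -> R;
  pg : nat;
  plo : nat -> R;
  phi : nat -> R
}.

Definition in01 (x : R) : Prop := 0 <= x < 1.

Definition in_int (F : PMap) (k : nat) (x : R) : Prop :=
  plo F k <= x < phi F k.

Definition is_word (g m : nat) (w : list nat) : Prop :=
  length w = m /\ Forall (fun a => (a < g)%nat) w.

Definition cylinder (F : PMap) (w : list nat) (x : R) : Prop :=
  in01 x /\
  forall i, (i < length w)%nat -> in_int F (nth i w 0%nat) (Nat.iter i (pf F) x).

Definition prefix (c : nat -> nat) (n : nat) : list nat := map c (seq 0 n).

Definition setting (F : PMap) : Prop :=
  (2 <= pg F)%nat /\
  (forall k, (k < pg F)%nat -> 0 <= plo F k < phi F k /\ phi F k <= 1) /\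
  (forall x, in01 x -> exists! k, (k < pg F)%nat /\ in_int F k x) /\
  (forall x, in01 x -> in01 (pf F x)) /\
  (forall k, (k < pg F)%nat ->
     ((forall x y, in_int F k x -> in_int F k y -> x <= y -> pf F x <= pf F y) \/
      (forall x y, in_int F k x -> in_int F k y -> x <= y -> pf F y <= pf F x)) /\
     (forall y, in01 y -> exists x, in_int F k x /\ pf F x = y) /\
     (forall x y, in_int F k x -> in_int F k y ->
        Rabs (pf F x - pf F y) >= Rabs (x - y))) /\
  (forall c : nat -> nat, (forall i, (c i < pg F)%nat) ->
     forall eps, 0 < eps -> exists N, forall n, (N <= n)%nat ->
       forall x y, cylinder F (prefix c n) x -> cylinder F (prefix c n) y ->
         Rabs (x - y) < eps).

(* derivative of G at x relative to the set S (here: a cylinder, which is an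
   interval; at its left endpoint this is the one-sided derivative) *)
Definition rel_deriv (G : R -> R) (S : R -> Prop) (x l : R) : Prop :=
  limit1_in (fun y => (G y - G x) / (y - x)) (fun y => S y /\ y <> x) l x.

Definition cond_i (F : PMap) : Prop :=
  exists K, 0 < K /\
    forall w, is_word (pg F) (length w) w ->
      forall y z, cylinder F w y -> cylinder F w z ->
        exists ly lz,
          rel_deriv (Nat.iter (length w) (pf F)) (cylinder F w) y ly /\
          rel_deriv (Nat.iter (length w) (pf F)) (cylinder F w) z lz /\
          Rabs ly < K * Rabs lz.

(* c is the f-expansion (coding sequence) of x; c i = x_{i+1} *)
Definition coding (F : PMap) (x : R) (c : nat -> nat) : Prop :=
  forall i, (c i < pg F)%nat /\ in_int F (c i) (Nat.iter i (pf F) x).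

Definition matchb (c : nat -> nat) (w : list nat) (j : nat) : bool :=
  forallb (fun l => Nat.eqb (c (j + l)%nat) (nth l w 0%nat)) (seq 0 (length w)).

Definition tau (c : nat -> nat) (w : list nat) (n : nat) : nat :=
  length (filter (matchb c w) (seq 0 (n - length w))).

(* the sequence tau_w(x,n)/(n-m) for n > m, reindexed by n = k + m + 1 *)
Definition freq (c : nat -> nat) (w : list nat) (k : nat) : R :=
  INR (tau c w (k + length w + 1)) / INR (k + 1).

Fixpoint all_words (g m : nat) : list (list nat) :=
  match m with
  | O => [[]]
  | S m' => flat_map (fun a => map (cons a) (all_words g m')) (seq 0 g)
  end.

Definition is_prob (g m : nat) (p : list nat -> R) : Prop :=
  (forall w, is_word g m w -> 0 <= p w <= 1) /\
  fold_right Rplus 0 (map p (all_words g m)) = 1.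

Definition Gset (F : PMap) (m : nat) (p : list nat -> R) (x : R) : Prop :=
  in01 x /\ exists c, coding F x c /\
    forall w, is_word (pg F) m w -> Un_cv (freq c w) (p w).

Definition cond_ii (F : PMap) : Prop :=
  forall m, (1 <= m)%nat ->
    exists p, is_prob (pg F) m p /\ is_hdim (Gset F m p) 1 /\
      forall w, is_word (pg F) m w -> forall delta, 0 < delta ->
        exists q, is_prob (pg F) m q /\ q w <> p w /\
          exists d, is_hdim (Gset F m q) d /\ d > 1 - delta.

Definition divergent_set (fs : nat -> PMap) (x : R) : Prop :=
  in01 x /\ forall i, exists c, coding (fs i) x c /\
    forall m, (1 <= m)%nat -> forall w, is_word (pg (fs i)) m w ->
      ~ (exists L, Un_cv (freq c w) L).

(* Main.v *)
Require Import Defs.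
From Stdlib Require Import Reals.
From Stdlib Require Import Lra Lia List PeanoNat Classical ClassicalEpsilon.
From Stdlib Require Import PArith FinFun Cantor.
(* [Reals] has its own [in_int]; this makes the one of [Defs] visible again. *)
Require Import Defs.
Import ListNotations.
Open Scope R_scope.

(** The frequency of [w] along [x] diverges as soon as it comes arbitrarily
    close, infinitely often, to two different values, so the set contains a
    countable intersection of sets [visits], each of them open up to endpoints
    of cylinders.  Fix [s < 1].  A node (dyadic interval) [I] contains a
    cylinder of comparable length, on which an iterate of [f] is onto [0,1)
    with bounded distortion.  Pulling back a set [Gset] that is not
    [s]-null shows that covers of [visits] inside [I] by nodes cost at least
    [c * |I|^s], with [c] independent of [I].  Since [2 * 2^(-s) > 1],
    passing to subintervals improves [c] to [1], as in Falconer's theory of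
    sets with large intersections.  Now let [S] be a family of nodes of total
    cost less than [1].  Starting from [0,1), one can repeatedly choose, inside
    the next open set, a smaller node in which [S] still costs less than the
    node itself; the common point lies in all the sets and is not covered
    by [S]. *)

(** * Finite sums and dyadic intervals *)

Definition lsum {A : Type} (w : A -> R) (l : list A) : R :=
  fold_right Rplus 0 (map w l).

Lemma lsum_cons {A} (w : A -> R) a l : lsum w (a :: l) = w a + lsum w l.
Proof. reflexivity. Qed.

Lemma lsum_app {A} (w : A -> R) l l' : lsum w (l ++ l') = lsum w l + lsum w l'.
Proof.
  induction l as [|a l IH]; simpl; [unfold lsum; simpl; lra|].
  rewrite !lsum_cons, IH; lra.
Qed.

Lemma lsum_nonneg {A} (w : A -> R) l : (forall x, 0 <= w x) -> 0 <= lsum w l.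
Proof.
  intros Hw; induction l as [|a l IH]; [unfold lsum; simpl; lra|].
  rewrite lsum_cons; specialize (Hw a); lra.
Qed.

Lemma lsum_le {A} (w w' : A -> R) l :
  (forall x, In x l -> w x <= w' x) -> lsum w l <= lsum w' l.
Proof.
  induction l as [|a l IH]; intros H; [unfold lsum; simpl; lra|].
  rewrite !lsum_cons.
  assert (w a <= w' a) by (apply H; now left).
  assert (lsum w l <= lsum w' l) by (apply IH; intros; apply H; now right).
  lra.
Qed.

Lemma lsum_scal {A} (w : A -> R) c l : lsum (fun x => c * w x) l = c * lsum w l.
Proof.
  induction l as [|a l IH]; [unfold lsum; simpl; lra|].
  rewrite !lsum_cons, IH; lra.
Qed.

Lemma lsum_map {A B} (f : A -> B) (w : B -> R) l :
  lsum w (map f l) = lsum (fun x => w (f x)) l.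
Proof. unfold lsum; now rewrite map_map. Qed.

Lemma lsum_concat_map {A B} (f : A -> list B) (w : B -> R) l :
  lsum w (concat (map f l)) = lsum (fun x => lsum w (f x)) l.
Proof.
  induction l as [|a l IH]; [reflexivity|].
  simpl; rewrite lsum_app, lsum_cons, IH; reflexivity.
Qed.

Lemma lsum_incl {A} (w : A -> R) l : (forall x, 0 <= w x) -> NoDup l ->
  forall l', incl l l' -> lsum w l <= lsum w l'.
Proof.
  intros Hw Hnd; induction Hnd as [|a l Ha Hnd IH]; intros l' Hi.
  - apply lsum_nonneg, Hw.
  - destruct (in_split a l' (Hi a (or_introl eq_refl))) as (l1 & l2 & ->).
    rewrite lsum_app, !lsum_cons.
    assert (H : lsum w l <= lsum w (l1 ++ l2)).
    { apply IH; intros x Hx.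
      assert (Hin := Hi x (or_intror Hx)).
      apply in_app_iff in Hin; apply in_app_iff.
      destruct Hin as [?|[->|?]]; tauto. }
    rewrite lsum_app in H; lra.
Qed.

Lemma sum_f_R0_lsum (f : nat -> R) N : sum_f_R0 f N = lsum f (seq 0 (S N)).
Proof.
  induction N as [|N IH]; [unfold lsum; simpl; lra|].
  rewrite (seq_S (S N)), lsum_app, <- IH.
  simpl; unfold lsum; simpl; lra.
Qed.

(** The head is the last binary digit, so [b :: I] is a half of [I] and the nodes containing [I] are
    its suffixes. *)
Definition node := list bool.

Fixpoint dleft (I : node) : R :=
  match I with
  | [] => 0
  | b :: I' => dleft I' + (if b then (/2) ^ S (length I') else 0)
  end.

Definition dlen (I : node) : R := (/2) ^ length I.

Definition inD (I : node) (x : R) : Prop := dleft I <= x < dleft I + dlen I.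

Definition below (J I : node) : Prop := exists l, J = l ++ I.

Lemma dlen_pos I : 0 < dlen I.
Proof. apply pow_lt; lra. Qed.

Lemma dlen_le1 I : dlen I <= 1.
Proof.
  unfold dlen; induction (length I) as [|n IH]; simpl; [lra|].
  assert (0 < (/2) ^ n) by (apply pow_lt; lra). lra.
Qed.

Lemma below_refl I : below I I.
Proof. now exists []. Qed.

Lemma below_trans K J I : below K J -> below J I -> below K I.
Proof. intros [l ->] [l' ->]; exists (l ++ l'); apply app_assoc. Qed.

Lemma below_length J I : below J I -> (length I <= length J)%nat.
Proof. intros [l ->]; rewrite length_app; lia. Qed.

Lemma below_antisym J I : below J I -> (length J <= length I)%nat -> J = I.
Proof.
  intros [l ->]; rewrite length_app; intros H.
  destruct l; [reflexivity|simpl in H; lia].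
Qed.

Lemma below_total K I J : below K I -> below K J -> below I J \/ below J I.
Proof.
  intros [l ->] [l' H]; apply app_eq_app in H.
  destruct H as (m & [[_ H]|[_ H]]); [right|left]; now exists m.
Qed.

Lemma below_cons K b I : below K (b :: I) -> below K I.
Proof. intros H; apply (below_trans _ _ _ H); now exists [b]. Qed.

Lemma below_cons_inv b I J : below (b :: I) J -> J = b :: I \/ below I J.
Proof.
  intros [[|a l] H]; simpl in H; [left; congruence|].
  right; exists l; congruence.
Qed.

Lemma inD_cons b I x : inD (b :: I) x -> inD I x.
Proof.
  unfold inD, dlen; simpl.
  assert (0 < (/2) ^ length I) by (apply pow_lt; lra).
  destruct b; lra.
Qed.

Lemma inD_below J I x : below J I -> inD J x -> inD I x.
Proof.
  intros [l ->]; induction l as [|b l IH]; simpl; [tauto|].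
  intros H; apply IH; revert H; apply inD_cons.
Qed.

Lemma inD_inj I J x : length I = length J -> inD I x -> inD J x -> I = J.
Proof.
  revert J; induction I as [|a I IH]; intros [|b J] Hl HI HJ; simpl in Hl; try lia.
  - reflexivity.
  - injection Hl as Hl.
    assert (E := IH J Hl (inD_cons _ _ _ HI) (inD_cons _ _ _ HJ)); subst J.
    f_equal; unfold inD, dlen in *; simpl in *; destruct a, b; auto; lra.
Qed.

Lemma inD_below_of_length I J x :
  inD I x -> inD J x -> (length J <= length I)%nat -> below I J.
Proof.
  intros HI HJ Hl.
  assert (E := firstn_skipn (length I - length J) I).
  assert (B : below I (skipn (length I - length J) I)) by (eexists; symmetry; exact E).
  assert (K : skipn (length I - length J) I = J).
  { apply inD_inj with x; auto.
    - rewrite length_skipn; lia.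
    - now apply inD_below with I. }
  now rewrite K in B.
Qed.

Lemma inD_comparable I J x : inD I x -> inD J x -> below I J \/ below J I.
Proof.
  intros HI HJ; destruct (Nat.le_ge_cases (length J) (length I));
    [left|right]; now apply inD_below_of_length with x.
Qed.

(** For [x] outside [0,1) the descent ends in the leftmost or the rightmost node, which is harmless
    in [nd_neighbours]. *)
Fixpoint nd (n : nat) (x : R) : node :=
  match n with
  | O => []
  | S n' => (if Rlt_le_dec x (dleft (nd n' x) + (/2) ^ S n') then false else true)
            :: nd n' x
  end.

Lemma nd_length n x : length (nd n x) = n.
Proof. induction n; simpl; auto. Qed.

Lemma nd_spec n x : in01 x -> inD (nd n x) x.
Proof.
  intros Hx; induction n as [|n IH].
  - unfold inD, dlen; simpl; unfold in01 in Hx; lra.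
  - unfold inD, dlen in *; simpl; rewrite nd_length in *.
    destruct Rlt_le_dec as [H|H]; simpl in H; lra.
Qed.

Lemma dleft_grid I : exists k : nat, dleft I = INR k * dlen I.
Proof.
  induction I as [|b I [k IH]]; [exists 0%nat; simpl; lra|].
  unfold dlen in *; simpl; rewrite IH.
  exists (2 * k + if b then 1 else 0)%nat.
  rewrite plus_INR, mult_INR; destruct b; simpl; lra.
Qed.

Lemma inD_in01 I x : inD I x -> in01 x.
Proof.
  intros H; assert (B : below I []) by (exists I; now rewrite app_nil_r).
  generalize (inD_below _ _ _ B H); unfold inD, in01, dlen; simpl; lra.
Qed.

Lemma inD_dist I x y : inD I x -> inD I y -> Rabs (x - y) <= dlen I.
Proof. unfold inD; intros; apply Rabs_le; lra. Qed.

(** The left endpoints of the two nodes are [j] and [k] times [(/2) ^ n], and closeness of the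
    points forces [j] and [k] to differ by at most 1. *)
Lemma nd_neighbours n x y : in01 x -> in01 y -> Rabs (x - y) < (/2) ^ n ->
  In (nd n y) [nd n (x - (/2) ^ n); nd n x; nd n (x + (/2) ^ n)].
Proof.
  intros Hx Hy Hxy.
  assert (Hp : 0 < (/2) ^ n) by (apply pow_lt; lra).
  assert (Dx := nd_spec n x Hx); assert (Dy := nd_spec n y Hy).
  destruct (dleft_grid (nd n x)) as [j Hj]; destruct (dleft_grid (nd n y)) as [k Hk].
  unfold inD, dlen in *; rewrite !nd_length in *; rewrite Hj, Hk in *.
  apply Rabs_def2 in Hxy.
  assert (INR k < INR j + 2) by nra.
  assert (INR j < INR k + 2) by nra.
  assert (Hjk : k = j \/ k = S j \/ j = S k).
  { change 2 with (INR 2) in *; rewrite <- plus_INR in *.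
    apply INR_lt in H; apply INR_lt in H0; lia. }
  assert (Q : forall z, INR k * (/2) ^ n <= z < INR k * (/2) ^ n + (/2) ^ n ->
     nd n y = nd n z).
  { intros z Hz.
    assert (Dz : inD (nd n y) z).
    { unfold inD, dlen; rewrite nd_length, Hk; exact Hz. }
    apply inD_inj with z; auto.
    - now rewrite !nd_length.
    - apply nd_spec, (inD_in01 _ _ Dz). }
  destruct Hjk as [E|[E|E]].
  - right; left; symmetry; apply Q; rewrite E; lra.
  - right; right; left; symmetry; apply Q; rewrite E, S_INR; lra.
  - left; symmetry; apply Q; rewrite E, S_INR in Dx; lra.
Qed.

(** * Covers by dyadic nodes *)

Lemma choice {A B : Type} (P : A -> B -> Prop) :
  (forall a, exists b, P a b) -> exists f, forall a, P a (f a).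
Proof.
  intros H; exists (fun a => proj1_sig (constructive_indefinite_description _ (H a))).
  intros a; apply proj2_sig.
Qed.

Lemma Rpower_pos x y : 0 < Rpower x y.
Proof. apply exp_pos. Qed.

Lemma Rpower_base1 s : Rpower 1 s = 1.
Proof. unfold Rpower; rewrite ln_1, Rmult_0_r; apply exp_0. Qed.

Lemma Rpower_inv x s : 0 < x -> Rpower (/ x) s = / Rpower x s.
Proof.
  intros Hx; unfold Rpower; rewrite ln_Rinv, <- exp_Ropp by auto; f_equal; lra.
Qed.

Lemma Rpower_half_lt1 s : 0 < s -> Rpower (/2) s < 1.
Proof.
  intros Hs; rewrite Rpower_inv by lra.
  rewrite <- Rinv_1; apply Rinv_lt_contravar.
  - rewrite Rmult_1_l; apply Rpower_pos.
  - rewrite <- (Rpower_O 2) by lra; apply Rpower_lt; lra.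
Qed.

Lemma Rpower_half_gt_half s : s < 1 -> / 2 < Rpower (/2) s.
Proof.
  intros Hs; rewrite Rpower_inv by lra.
  apply Rinv_lt_contravar.
  - apply Rmult_lt_0_compat; [apply Rpower_pos|lra].
  - rewrite <- (Rpower_1 2) at 2 by lra; apply Rpower_lt; lra.
Qed.

Lemma Rpower_half_pow s n : Rpower ((/2) ^ n) s = Rpower (/2) s ^ n.
Proof.
  rewrite <- (Rpower_pow n (/2)), <- (Rpower_pow n (Rpower (/2) s)) by (apply Rpower_pos || lra).
  rewrite !Rpower_mult; f_equal; lra.
Qed.

Lemma dyadic_level r : 0 < r < 1 -> exists n, (/2) ^ S n <= r < (/2) ^ n.
Proof.
  intros [H0 H1].
  destruct (pow_lt_1_zero (/2)) with (y := r) as [N HN]; auto.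
  { rewrite Rabs_right; lra. }
  specialize (HN N (le_n _)); rewrite Rabs_right in HN
    by (apply Rle_ge, pow_le; lra).
  apply Rlt_le in HN.
  induction N as [|N IH]; [simpl in HN; lra|].
  destruct (Rlt_le_dec r ((/2) ^ N)) as [H|H]; [|auto].
  exists N; split; auto.
Qed.

(** Three neighbouring nodes at the level with [(/2) ^ S n <= r < (/2) ^ n] suffice. Being at most
    twice as long as [r], each costs at most [Rpower r s / Rpower (/2) s]. *)
Lemma node_cover_of_small_set s r (U : R -> Prop) : 0 < s -> 0 < r < 1 ->
  (forall x y, U x -> U y -> Rabs (x - y) <= r) ->
  exists t : list node,
    (forall x, in01 x -> U x -> exists J, In J t /\ inD J x) /\
    lsum (fun J => Rpower (/2) s ^ length J) t <= 3 / Rpower (/2) s * Rpower r s.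
Proof.
  intros Hs Hr HU; set (rho := Rpower (/2) s).
  assert (Hrho : 0 < rho) by apply Rpower_pos.
  assert (Hpos : 0 < 3 / rho) by (apply Rdiv_lt_0_compat; lra).
  destruct (classic (exists x, in01 x /\ U x)) as [(x & Hx & Ux)|He].
  - destruct (dyadic_level r Hr) as (n & Hn1 & Hn2).
    exists [nd n (x - (/2) ^ n); nd n x; nd n (x + (/2) ^ n)]; split.
    + intros y Hy Uy; exists (nd n y); split; [|now apply nd_spec].
      apply nd_neighbours; auto.
      specialize (HU x y Ux Uy); lra.
    + unfold lsum; simpl; rewrite !nd_length.
      assert (H : rho ^ S n <= Rpower r s).
      { unfold rho; rewrite <- Rpower_half_pow; apply Rle_Rpower_l; [lra|].
        split; auto; apply pow_lt; lra. }
      simpl in H.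
      replace (rho ^ n + (rho ^ n + (rho ^ n + 0))) with (3 / rho * (rho * rho ^ n))
        by (field; lra).
      apply Rmult_le_compat_l; lra.
  - exists []; split.
    + intros x Hx Ux; exfalso; eauto.
    + unfold lsum; simpl; assert (0 < Rpower r s) by apply Rpower_pos; nra.
Qed.

Lemma Hnull_node_cover s E : 0 < s -> Hnull s E ->
  exists S : node -> Prop,
    (forall x, in01 x -> E x -> exists J, S J /\ inD J x) /\
    forall l, NoDup l -> (forall J, In J l -> S J) ->
      lsum (fun J => Rpower (/2) s ^ length J) l < 1.
Proof.
  intros Hs HE; set (rho := Rpower (/2) s).
  assert (Hrho : 0 < rho) by apply Rpower_pos.
  assert (Hrho1 : rho < 1) by now apply Rpower_half_lt1.
  (* Replacing sets by nodes multiplies the cost by [3 / rho], so the level [rho / 4] leaves a total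
     of at most 3/4. It also makes every radius smaller than 1. *)
  assert (Heps : 0 < rho / 4) by lra.
  destruct (HE _ Heps) as (U & r & HUc & HUr & HUs).
  assert (Hterm : forall i, Rpower (r i) s < 1).
  { intros i; specialize (HUs i); rewrite sum_f_R0_lsum, seq_S, lsum_app in HUs.
    assert (0 <= lsum (fun i0 => Rpower (r i0) s) (seq 0 i))
      by (apply lsum_nonneg; intros; apply Rlt_le, Rpower_pos).
    unfold lsum in HUs at 2; simpl in HUs; lra. }
  assert (Hr1 : forall i, 0 < r i < 1).
  { intros i; destruct (HUr i) as [H _]; split; auto.
    destruct (Rlt_le_dec (r i) 1) as [?|Hge]; auto.
    assert (H1 : Rpower 1 s <= Rpower (r i) s) by (apply Rle_Rpower_l; lra).
    rewrite Rpower_base1 in H1; specialize (Hterm i); lra. }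
  destruct (choice _ (fun i => node_cover_of_small_set s (r i) (U i) Hs (Hr1 i)
     (proj2 (HUr i)))) as (t & Ht).
  exists (fun J => exists i, In J (t i)); split.
  - intros x Hx Ex; destruct (HUc x Ex) as [i Hi].
    destruct (proj1 (Ht i) x Hx Hi) as (J & HJ & HJx); eauto.
  - intros l Hnd Hl.
    (* A finite list of nodes draws on finitely many of the lists [t i]. *)
    assert (HN : exists N, incl l (concat (map t (seq 0 (S N))))).
    { clear Hnd; induction l as [|J l IH].
      - exists 0%nat; intros J [].
      - destruct IH as [N HN]; [intros; apply Hl; now right|].
        destruct (Hl J (or_introl eq_refl)) as [i Hi].
        exists (Nat.max i N); intros K [<-|HK]; apply in_concat.
        + exists (t i); split; auto; apply in_map, in_seq; lia.
        + apply HN, in_concat in HK; destruct HK as (k & Hk & HK).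
          exists k; split; auto.
          apply in_map_iff in Hk; destruct Hk as (j & <- & Hj).
          apply in_map; rewrite in_seq in *; lia. }
    destruct HN as [N HN].
    apply lsum_incl with (w := fun J => rho ^ length J) in HN;
      [|intros; apply pow_le; lra|auto].
    rewrite lsum_concat_map in HN.
    assert (H := lsum_le _ (fun i => 3 / rho * Rpower (r i) s) (seq 0 (S N))
      (fun i _ => proj2 (Ht i))).
    rewrite lsum_scal in H; specialize (HUs N); rewrite sum_f_R0_lsum in HUs.
    apply Rmult_le_compat_l with (r := 3 / rho) in HUs;
      [|apply Rlt_le, Rdiv_lt_0_compat; lra].
    replace (3 / rho * (rho / 4)) with (3 / 4) in HUs by (field; lra).
    fold rho in H; lra.
Qed.

Lemma seq_even_odd N : incl (seq 0 N)
  (map (fun i => 2 * i)%nat (seq 0 N) ++ map (fun i => 2 * i + 1)%nat (seq 0 N)).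
Proof.
  intros i Hi; apply in_seq in Hi; apply in_app_iff; rewrite !in_map_iff.
  destruct (Nat.Even_or_Odd i) as [[j ->]|[j ->]]; [left|right]; exists j;
    rewrite in_seq; lia.
Qed.

Lemma lsum_geom a N : 0 <= a -> lsum (fun i => a * (/2) ^ i) (seq 0 N) <= 2 * a.
Proof.
  intros Ha.
  assert (H : lsum (fun i => a * (/2) ^ i) (seq 0 N) = 2 * a - 2 * a * (/2) ^ N).
  { induction N as [|N IH]; [unfold lsum; simpl; lra|].
    rewrite seq_S, lsum_app, IH; unfold lsum; simpl; lra. }
  assert (0 <= (/2) ^ N) by (apply pow_le; lra).
  rewrite H; nra.
Qed.

(* The indices outside [A] and the points [e i] are given radii whose
   [s]-th powers form a geometric series. *)
Lemma cover_up_to_countable s eps (E : R -> Prop) (A : nat -> Prop)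
    (U : nat -> R -> Prop) (r : nat -> R) (e : nat -> R) :
  0 < s -> 0 < eps ->
  (forall x, E x -> (exists i, A i /\ U i x) \/ exists i, e i = x) ->
  (forall i, A i -> 0 < r i /\ forall x y, U i x -> U i y -> Rabs (x - y) <= r i) ->
  (forall N, lsum (fun i => if excluded_middle_informative (A i)
                            then Rpower (r i) s else 0) (seq 0 N) <= eps / 2) ->
  exists (U' : nat -> R -> Prop) (r' : nat -> R),
    (forall x, E x -> exists i, U' i x) /\
    (forall i, 0 < r' i /\ forall x y, U' i x -> U' i y -> Rabs (x - y) <= r' i) /\
    (forall N, sum_f_R0 (fun i => Rpower (r' i) s) N <= eps).
Proof.
  intros Hs He Hc Hr Hsum.
  (* The [s]-th powers of [eta] sum to at most [eps / 4]. They are spent at most twice, on even and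
     on odd indices, which uses the remaining [eps / 2]. *)
  set (eta := fun i => Rpower (eps / 8 * (/2) ^ i) (/ s)).
  assert (Heta : forall i, Rpower (eta i) s = eps / 8 * (/2) ^ i).
  { intros i; unfold eta; rewrite Rpower_mult, Rinv_l, Rpower_1; [auto| |lra].
    apply Rmult_lt_0_compat; [lra|apply pow_lt; lra]. }
  (* Index [2 * i] carries [U i], or the empty set when [A i] fails; index [2 * i + 1] carries the
     single point [e i]. *)
  exists (fun i x => if Nat.even i then A (Nat.div2 i) /\ U (Nat.div2 i) x
                     else e (Nat.div2 i) = x),
    (fun i => if Nat.even i then
       if excluded_middle_informative (A (Nat.div2 i)) then r (Nat.div2 i)
       else eta (Nat.div2 i) else eta (Nat.div2 i)).
  assert (Ev : forall i, Nat.even (2 * i) = true) by (intros; now rewrite Nat.even_mul).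
  assert (Od : forall i, Nat.even (2 * i + 1) = false)
    by (intros; now rewrite Nat.even_add, Nat.even_mul).
  assert (Od2 : forall i, Nat.div2 (2 * i + 1) = i)
    by (intros; rewrite Nat.add_1_r; apply Nat.div2_succ_double).
  split; [|split].
  - intros x Ex; destruct (Hc x Ex) as [(i & Ai & Ui)|[i Hi]].
    + exists (2 * i)%nat; now rewrite Ev, Nat.div2_double.
    + exists (2 * i + 1)%nat; now rewrite Od, Od2.
  - intros i; destruct (Nat.even i); [destruct excluded_middle_informative as [a|a]|].
    + split; [apply Hr, a|]; intros x y [_ Ux] [_ Uy]; now apply Hr.
    + split; [apply Rpower_pos|]; intros x y [? _]; tauto.
    + split; [apply Rpower_pos|]; intros x y <- <-.
      rewrite Rminus_diag, Rabs_R0; apply Rlt_le, Rpower_pos.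
  - intros N; rewrite sum_f_R0_lsum.
    eapply Rle_trans; [eapply lsum_incl; [|apply seq_NoDup|apply seq_even_odd]|].
    { intros; apply Rlt_le, Rpower_pos. }
    rewrite lsum_app, !lsum_map.
    assert (H1 := lsum_geom (eps / 8) (S N) ltac:(lra)).
    assert (H2 := Hsum (S N)).
    assert (H3 : forall l, lsum (fun x => Rpower
        (if Nat.even (2 * x + 1) then
           if excluded_middle_informative (A (Nat.div2 (2 * x + 1)))
           then r (Nat.div2 (2 * x + 1)) else eta (Nat.div2 (2 * x + 1))
         else eta (Nat.div2 (2 * x + 1))) s) l <= lsum (fun i => eps / 8 * (/2) ^ i) l).
    { intros l; apply lsum_le; intros i _; rewrite Od, Od2, Heta; lra. }
    assert (H4 : forall l, lsum (fun x => Rpower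
        (if Nat.even (2 * x) then
           if excluded_middle_informative (A (Nat.div2 (2 * x)))
           then r (Nat.div2 (2 * x)) else eta (Nat.div2 (2 * x))
         else eta (Nat.div2 (2 * x))) s) l <=
       lsum (fun i => if excluded_middle_informative (A i) then Rpower (r i) s else 0) l
       + lsum (fun i => eps / 8 * (/2) ^ i) l).
    { induction l as [|i l IH]; [unfold lsum; simpl; lra|].
      rewrite !lsum_cons, Ev, Nat.div2_double.
      assert (0 < (/2) ^ i) by (apply pow_lt; lra).
      destruct excluded_middle_informative; [nra|rewrite Heta; lra]. }
    specialize (H3 (seq 0 (S N))); specialize (H4 (seq 0 (S N))); lra.
Qed.

Lemma nat_floor N y : 0 <= y < INR N -> exists i, (i < N)%nat /\ INR i <= y < INR i + 1.
Proof.
  induction N as [|N IH]; intros H; [simpl in H; lra|].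
  destruct (Rlt_le_dec y (INR N)) as [Hy|Hy].
  - destruct IH as (i & Hi & Hyi); [lra|]; exists i; split; [lia|auto].
  - exists N; rewrite S_INR in H; split; [lia|lra].
Qed.

(** [N] intervals of length [/ INR N] cost [N] to the power [1 - s], which is at most [eps / 2] once
    [N] exceeds [2 / eps] to the power [/ (s - 1)]. *)
Lemma Hnull_gt1 s E : 1 < s -> (forall x, E x -> in01 x) -> Hnull s E.
Proof.
  intros Hs HE eps He.
  destruct (INR_unbounded (Rpower (2 / eps) (/ (s - 1)))) as [N HN].
  assert (Hp := Rpower_pos (2 / eps) (/ (s - 1))).
  assert (HN0 : 0 < INR N) by lra.
  assert (H2 : 2 / eps <= Rpower (INR N) (s - 1)).
  { rewrite <- (Rpower_1 (2 / eps)) by (apply Rdiv_lt_0_compat; lra).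
    replace 1 with (/ (s - 1) * (s - 1)) at 1 by (field; lra).
    rewrite <- Rpower_mult; apply Rle_Rpower_l; lra. }
  apply cover_up_to_countable with (A := fun i => (i < N)%nat)
    (U := fun i x => INR i / INR N <= x < (INR i + 1) / INR N)
    (r := fun _ => / INR N) (e := fun _ => 0); auto; [lra| | |].
  - intros x Ex; left.
    destruct (HE x Ex) as [Hx0 Hx1].
    destruct (nat_floor N (x * INR N)) as (i & Hi & Hxi); [nra|].
    exists i; repeat split; auto.
    + apply Rmult_le_reg_r with (INR N); auto; field_simplify; lra.
    + apply Rmult_lt_reg_r with (INR N); auto; field_simplify; lra.
  - intros i Hi; split; [now apply Rinv_0_lt_compat|].
    intros x y Hx Hy; unfold Rdiv in *; apply Rabs_le; lra.
  - assert (Hb : forall M, lsum (fun i => if excluded_middle_informative (i < N)%nat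
        then Rpower (/ INR N) s else 0) (seq 0 M) <= INR (Nat.min M N) * Rpower (/ INR N) s).
    { assert (Hq := Rpower_pos (/ INR N) s).
      induction M as [|M IH]; [unfold lsum; simpl; lra|].
      rewrite seq_S, lsum_app; unfold lsum at 2; simpl Nat.add; cbn [map fold_right].
      destruct excluded_middle_informative as [h|h].
      - rewrite Nat.min_l in * by lia; rewrite S_INR; lra.
      - rewrite Nat.min_r in * by lia; lra. }
    intros M; apply Rle_trans with (1 := Hb M).
    apply Rle_trans with (INR N * Rpower (/ INR N) s).
    { apply Rmult_le_compat_r; [apply Rlt_le, Rpower_pos|apply le_INR; lia]. }
    replace (Rpower (/ INR N) s) with (/ INR N * / Rpower (INR N) (s - 1)).
    + rewrite <- Rmult_assoc, Rinv_r, Rmult_1_l by lra.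
      replace (eps / 2) with (/ (2 / eps)) by (field; lra).
      apply Rinv_le_contravar; auto; apply Rdiv_lt_0_compat; lra.
    + rewrite <- (Rpower_1 (INR N)) at 1 by auto.
      rewrite Rpower_inv, <- Rinv_mult, <- Rpower_plus by auto; do 2 f_equal; lra.
Qed.

(** * Sets of full content in every node *)

(* A lower bound, proportional to [rho ^ length I], for the content of [V]
   inside every node [I], stated on covers by nodes. *)
Definition heavy (rho c : R) (V : R -> Prop) : Prop :=
  forall (I : node) (T : node -> Prop),
    (forall x, V x -> inD I x -> exists J, T J /\ inD J x) ->
    (exists J, T J /\ below I J) \/
    exists l, NoDup l /\ (forall J, In J l -> T J /\ below J I) /\
      c * rho ^ length I <= lsum (fun J => rho ^ length J) l.

Lemma heavy_le rho c c' V : 0 < rho -> c' <= c -> heavy rho c V -> heavy rho c' V.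
Proof.
  intros Hr Hc H I T HT; destruct (H I T HT) as [?|(l & H1 & H2 & H3)]; [now left|right].
  exists l; repeat split; try (apply H2; auto); auto.
  assert (0 < rho ^ length I) by now apply pow_lt.
  nra.
Qed.

Lemma heavy_subset rho c V W :
  (forall x, V x -> W x) -> heavy rho c V -> heavy rho c W.
Proof. intros HVW H I T HT; apply H; auto. Qed.

(** The bounds in the two halves of [I] add up, because no node lies in both. If a half itself
    belongs to [T], it serves as its own family, and [c <= 1] makes it expensive enough. *)
Lemma heavy_children rho c V : 0 < rho -> c <= 1 ->
  heavy rho c V -> heavy rho (2 * rho * c) V.
Proof.
  intros Hr Hc H I T HT.
  destruct (classic (exists J, T J /\ below I J)) as [?|Hn]; [now left|right].
  assert (Hb : forall b, exists l, NoDup l /\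
      (forall J, In J l -> T J /\ below J (b :: I)) /\
      c * rho ^ S (length I) <= lsum (fun J => rho ^ length J) l).
  { intros b; destruct (H (b :: I) T) as [(J & TJ & HJ)|?]; auto.
    - intros x Vx Ix; apply HT; auto; now apply inD_cons with b.
    - apply below_cons_inv in HJ; destruct HJ as [->|HJ]; [|exfalso; eauto].
      exists [b :: I]; split; [repeat constructor; simpl; tauto|split].
      + intros J [<-|[]]; split; auto; apply below_refl.
      + unfold lsum; simpl.
        assert (0 < rho * rho ^ length I) by (apply Rmult_lt_0_compat; auto; now apply pow_lt).
        nra. }
  destruct (Hb true) as (l1 & N1 & B1 & S1); destruct (Hb false) as (l2 & N2 & B2 & S2).
  exists (l1 ++ l2); split; [|split].
  - apply NoDup_app; auto; intros J H1 H2.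
    apply B1, proj2 in H1; apply B2, proj2 in H2.
    destruct (below_total _ _ _ H1 H2) as [E|E]; apply below_antisym in E;
      simpl; auto; discriminate.
  - intros J HJ; apply in_app_iff in HJ.
    destruct HJ as [HJ|HJ]; [apply B1 in HJ|apply B2 in HJ]; split; try apply HJ;
      eapply below_cons; apply HJ.
  - rewrite lsum_app; simpl in *; lra.
Qed.

(* Passing to the two children multiplies the constant by [2 * rho > 1]. *)
Lemma heavy_one rho c V : / 2 < rho -> 0 < c -> heavy rho c V -> heavy rho 1 V.
Proof.
  intros Hr Hc H.
  (* The cap at 1 keeps the constant within the range of [heavy_children]. *)
  assert (Hn : forall n, heavy rho (Rmin 1 (c * (2 * rho) ^ n)) V).
  { induction n as [|n IH].
    - apply heavy_le with c; [lra| |auto].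
      simpl; rewrite Rmult_1_r; apply Rmin_r.
    - apply heavy_le with (2 * rho * Rmin 1 (c * (2 * rho) ^ n)); [lra| |].
      + simpl; unfold Rmin; do 2 destruct Rle_dec; nra.
      + apply heavy_children; auto; [lra|apply Rmin_l]. }
  destruct (Pow_x_infinity (2 * rho)) with (b := / c) as [N HN].
  { rewrite Rabs_right; lra. }
  specialize (HN N (le_n _)).
  rewrite Rabs_right in HN by (apply Rle_ge, pow_le; lra).
  specialize (Hn N); rewrite Rmin_left in Hn; auto.
  apply Rmult_le_reg_l with (/ c); [now apply Rinv_0_lt_compat|].
  rewrite <- Rmult_assoc, Rinv_l, Rmult_1_l; lra.
Qed.

(** Each element of [l] is traded for a list that it owns. Since owners are unique, the
    concatenation has no repetitions and the costs add. *)
Lemma disjoint_refinement {A B : Type} (T : A -> Prop) (S : B -> Prop)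
    (own : B -> A -> Prop) (w : A -> R) (v : B -> R) :
  (forall K J J', T J -> T J' -> own K J -> own K J' -> J = J') ->
  (forall J, T J -> exists l, NoDup l /\ (forall K, In K l -> S K /\ own K J) /\
     w J <= lsum v l) ->
  forall l, NoDup l -> (forall J, In J l -> T J) ->
  exists L, NoDup L /\ (forall K, In K L -> S K /\ exists J, In J l /\ own K J) /\
    lsum w l <= lsum v L.
Proof.
  intros Hu Hw l Hnd; induction Hnd as [|J l HJ Hnd IH]; intros Hl.
  - exists []; split; [constructor|split; [intros K []|unfold lsum; simpl; lra]].
  - destruct IH as (L & N1 & B1 & S1); [intros; apply Hl; now right|].
    assert (TJ := Hl J (or_introl eq_refl)).
    destruct (Hw J TJ) as (L' & N2 & B2 & S2).
    exists (L' ++ L); split; [|split].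
    + apply NoDup_app; auto; intros K K1 K2.
      apply B2 in K1; apply B1 in K2; destruct K2 as (_ & J' & HJ' & HK).
      apply HJ; rewrite (Hu K J J'); auto; [|tauto].
      apply Hl; now right.
    + intros K HK; apply in_app_iff in HK; destruct HK as [HK|HK].
      * apply B2 in HK; split; [tauto|]; exists J; simpl; tauto.
      * apply B1 in HK; destruct HK as (? & J' & ? & ?); split; auto.
        exists J'; simpl; tauto.
    + rewrite lsum_app, lsum_cons; lra.
Qed.

(** * The nested-interval game *)

(* Right endpoints are included, so that a nested sequence has a common point. *)
Definition well_inside (V : R -> Prop) (I J : node) : Prop :=
  below J I /\
  forall x, dleft J <= x <= dleft J + dlen J -> V x /\ x < dleft I + dlen I.

(** The invariant of the game. The first clause keeps the limit point outside the nodes of [S]; the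
    second leaves room for the next move. *)
Definition uncovered (rho : R) (S : node -> Prop) (I : node) : Prop :=
  (forall J, S J -> ~ below I J) /\
  forall l, NoDup l -> (forall J, In J l -> S J /\ below J I) ->
    lsum (fun J => rho ^ length J) l < rho ^ length I.

Lemma well_inside_length V I J : well_inside V I J -> (length I < length J)%nat.
Proof.
  intros [HB HV]; destruct (Nat.lt_ge_cases (length I) (length J)) as [?|H]; auto.
  apply below_antisym in HB; auto; subst J.
  assert (H1 := dlen_pos I).
  destruct (HV (dleft I + dlen I)) as [_ ?]; lra.
Qed.

Lemma interior_well_inside V I x : interior V x -> inD I x ->
  exists J, well_inside V I J /\ inD J x.
Proof.
  intros [d Hd] Hx.
  (* A node around [x] shorter than [e] stays, with its right endpoint, inside [V] and strictly left
     of the right end of [I]. *)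
  set (e := Rmin d (dleft I + dlen I - x)).
  assert (He : 0 < e).
  { apply Rmin_glb_lt; [apply cond_pos|unfold inD in Hx; lra]. }
  destruct (pow_lt_1_zero (/2)) with (y := e) as [N HN]; auto.
  { rewrite Rabs_right; lra. }
  set (n := Nat.max N (length I)).
  assert (Hn := HN n ltac:(unfold n; lia)).
  rewrite Rabs_right in Hn by (apply Rle_ge, pow_le; lra).
  assert (HJ := nd_spec n x (inD_in01 _ _ Hx)).
  exists (nd n x); split; auto; split.
  - apply inD_below_of_length with x; auto; rewrite nd_length; unfold n; lia.
  - intros y Hy; unfold inD, dlen in HJ, Hy; rewrite nd_length in *.
    assert (He1 : e <= d) by apply Rmin_l.
    assert (He2 : e <= dleft I + dlen I - x) by apply Rmin_r.
    split; [|lra].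
    apply Hd; unfold disc; apply Rabs_def1; lra.
Qed.

(** A node has finitely many ancestors; the induction climbs towards the root as long as some proper
    ancestor satisfies [P]. *)
Lemma maximal_node (P : node -> Prop) J : (exists K, P K /\ below J K) ->
  exists K, P K /\ below J K /\ forall K', below K K' -> P K' -> K' = K.
Proof.
  induction J as [|b J IH]; intros (K & PK & HK).
  - exists K; split; [auto|split; auto].
    intros K' HK' _; apply below_antisym in HK; [|simpl; lia]; subst K.
    symmetry; apply below_antisym; [auto|simpl; lia].
  - destruct (classic (exists K, P K /\ below J K)) as [He|Hn].
    + destruct (IH He) as (K0 & H1 & H2 & H3); exists K0; repeat split; auto.
      apply below_trans with J; auto; now exists [b].
    + apply below_cons_inv in HK; destruct HK as [->|HK]; [|exfalso; eauto].
      exists (b :: J); split; [auto|split; [apply below_refl|]].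
      intros K' HK' PK'; apply below_cons_inv in HK'; destruct HK' as [?|HK']; auto.
      exfalso; eauto.
Qed.

(** If every node well inside [I] violated the invariant, cover [interior V] within [I] by the
    maximal such nodes that lie in no node of [S], together with the remaining nodes of [S].
    Heaviness yields a finite part costing at least as much as [I]. Each maximal node in it can be
    replaced by nodes of [S] costing no less, so [S] is too expensive in [I]. *)
Lemma game_step rho S V I : heavy rho 1 (interior V) -> uncovered rho S I ->
  exists J, well_inside V I J /\ uncovered rho S J.
Proof.
  intros HV [HI1 HI2]; apply NNPP; intros Hno.
  set (M := fun J => well_inside V I J /\
     forall J', below J J' -> well_inside V I J' -> J' = J).
  set (free := fun J => forall K, S K -> ~ below J K).
  set (TM := fun J => M J /\ free J).
  set (TS := fun J => S J /\ below J I /\ forall K, TM K -> ~ below J K).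
  destruct (HV I (fun J => TM J \/ TS J)) as [(J & TJ & HJ)|(l & Hnd & Hl & Hsum)].
  - intros x Vx Ix.
    destruct (interior_well_inside V I x Vx Ix) as (J0 & HJ0 & Jx0).
    destruct (maximal_node (well_inside V I) J0) as (J & HJ & HJ0J & Hmax).
    { exists J0; split; auto; apply below_refl. }
    assert (Jx := inD_below _ _ _ HJ0J Jx0).
    destruct (classic (free J)) as [HF|HF].
    + exists J; unfold TM, M; tauto.
    (* Some [K] in [S] contains [J]. It lies in [I], as it cannot contain [I]; and it lies in no
       node of [TM], since by maximality that node would be [J], which is not free. *)
    + apply not_all_ex_not in HF; destruct HF as [K HF].
      apply imply_to_and in HF; destruct HF as [SK HF]; apply NNPP in HF.
      assert (Kx := inD_below _ _ _ HF Jx).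
      exists K; split; auto; right; split; auto; split.
      * destruct (inD_comparable K I x Kx Ix) as [?|H]; auto.
        exfalso; now apply (HI1 K).
      * intros K' [[HK' _] HfK'] HKK'.
        assert (E : K' = J) by (apply Hmax; auto; now apply below_trans with K).
        subst K'; now apply (HfK' K).
  (* No member of the cover contains [I]: those of [TM] are strictly shorter, and those of [S] are
     excluded by the invariant. *)
  - destruct TJ as [[[HJ' _] _]|[SJ _]].
    + apply well_inside_length in HJ'; apply below_length in HJ; lia.
    + now apply (HI1 J).
  - set (own := fun K J => (TM J /\ below K J) \/ (TS J /\ K = J)).
    destruct (disjoint_refinement (fun J => TM J \/ TS J) S own
      (fun J => rho ^ length J) (fun J => rho ^ length J)) with (l := l)
      as (L & L1 & L2 & L3); auto.
    + intros K J J' _ _ [[H1 H2]|[H1 H2]] [[H3 H4]|[H3 H4]].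
      * destruct H1 as [[W1 M1] _], H3 as [[W3 M3] _].
        destruct (below_total _ _ _ H2 H4); [symmetry|]; auto.
      * subst K; exfalso; destruct H3 as (_ & _ & H3); now apply (H3 J).
      * subst K; exfalso; destruct H1 as (_ & _ & H1); now apply (H1 J').
      * congruence.
    + intros J [TJ|TJ].
      (* By [Hno] the invariant fails at [J]; as [J] is free, it fails through nodes of [S] inside
         [J] that cost at least as much as [J]. *)
      * assert (Hu : ~ uncovered rho S J).
        { intros Hu; apply Hno; exists J; split; auto; apply TJ. }
        apply NNPP; intros Hn; apply Hu; split; [apply TJ|].
        intros l0 N0 B0; apply Rnot_le_lt; intros Hle; apply Hn.
        exists l0; split; auto; split; auto.
        intros K HK; apply B0 in HK; split; [tauto|]; left; tauto.
      * exists [J]; split; [repeat constructor; simpl; tauto|split].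
        -- intros K [<-|[]]; split; [apply TJ|right; auto].
        -- unfold lsum; simpl; lra.
    + intros J HJ; now apply Hl.
    + assert (H : lsum (fun J => rho ^ length J) L < rho ^ length I).
      { apply HI2; auto; intros K HK; apply L2 in HK.
        destruct HK as (SK & J & HJ & HO); split; auto.
        apply Hl, proj2 in HJ; destruct HO as [[_ HO]|[_ ->]]; auto.
        now apply below_trans with J. }
      rewrite Rmult_1_l in Hsum.
      exact (Rlt_irrefl _ (Rle_lt_trans _ _ _ Hsum (Rle_lt_trans _ _ _ L3 H))).
Qed.

Lemma below_endpoints J I : below J I ->
  dleft I <= dleft J /\ dleft J + dlen J <= dleft I + dlen I.
Proof.
  intros [l ->]; induction l as [|b l IH]; [simpl; lra|].
  unfold dlen in *; simpl.
  assert (0 < (/2) ^ length (l ++ I)) by (apply pow_lt; lra).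
  destruct b; lra.
Qed.

(** The point is the supremum of the left endpoints. It lies in the closure of [I (S n)], hence in
    [V n] and strictly left of the right end of [I n]. *)
Lemma nested_point (V : nat -> R -> Prop) (I : nat -> node) :
  (forall n, well_inside (V n) (I n) (I (S n))) ->
  exists x, forall n, inD (I n) x /\ V n x.
Proof.
  intros H.
  assert (Hb : forall n k, below (I (k + n)%nat) (I n)).
  { intros n; induction k as [|k IH]; [apply below_refl|].
    apply below_trans with (2 := IH); apply H. }
  assert (Hle : forall m n, dleft (I m) <= dleft (I n) + dlen (I n)).
  { intros m n; destruct (Nat.le_ge_cases m n) as [h|h].
    - replace n with ((n - m) + m)%nat by lia.
      assert (B := below_endpoints _ _ (Hb m (n - m)%nat)).
      assert (P := dlen_pos (I (n - m + m)%nat)); lra.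
    - replace m with ((m - n) + n)%nat by lia.
      assert (B := below_endpoints _ _ (Hb n (m - n)%nat)).
      assert (P := dlen_pos (I (m - n + n)%nat)); lra. }
  destruct (completeness (fun y => exists n, y = dleft (I n))) as (x & Hub & Hlub).
  - exists (dleft (I 0%nat) + dlen (I 0%nat)); intros y [n ->]; apply Hle.
  - exists (dleft (I 0%nat)), 0%nat; reflexivity.
  - assert (Hx : forall n, dleft (I n) <= x <= dleft (I n) + dlen (I n)).
    { intros n; split; [apply Hub; eauto|].
      apply Hlub; intros y [m ->]; apply Hle. }
    exists x; intros n; destruct (proj2 (H n) x (Hx (S n))) as [H1 H2].
    split; auto; split; auto; apply Hx.
Qed.

(** The move at stage [n] is made inside [V n], so the common point lies in all of them. *)
Lemma point_outside_cover rho S (V : nat -> R -> Prop) :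
  (forall n, heavy rho 1 (interior (V n))) -> uncovered rho S [] ->
  exists x, in01 x /\ (forall n, V n x) /\ forall J, S J -> ~ inD J x.
Proof.
  intros HV H0.
  destruct (choice (fun (p : nat * node) J => uncovered rho S (snd p) ->
     well_inside (V (fst p)) (snd p) J /\ uncovered rho S J)) as [next Hnext].
  { intros [n I]; destruct (classic (uncovered rho S I)) as [HI|HI].
    - destruct (game_step rho S (V n) I (HV n) HI) as [J HJ]; exists J; auto.
    - exists []; simpl; tauto. }
  set (I := fix I n := match n with O => [] | S n' => next (n', I n') end).
  assert (HI : forall n, uncovered rho S (I n)).
  { induction n as [|n IH]; simpl; auto; now apply (Hnext (n, I n)). }
  assert (HW : forall n, well_inside (V n) (I n) (I (Datatypes.S n))).
  { intros n; apply (Hnext (n, I n)), HI. }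
  destruct (nested_point V I HW) as [x Hx].
  exists x; split; [apply (inD_in01 _ _ (proj1 (Hx 0%nat)))|split; [apply Hx|]].
  intros J SJ Jx.
  assert (Hlen : forall n, (n <= length (I n))%nat).
  { induction n as [|n IH]; [lia|]; specialize (HW n).
    apply well_inside_length in HW; lia. }
  (* The node of stage [length J] is at least as deep as [J]; if both contained [x], it would lie
     below [J], against the invariant. *)
  apply (proj1 (HI (length J)) J SJ).
  apply inD_below_of_length with x; auto; apply Hx.
Qed.

(** * Cylinders and expansions *)

Definition convex_set (S : R -> Prop) : Prop :=
  forall x y z, S x -> S z -> x <= y <= z -> S y.

Lemma in_int_in01 F k x : setting F -> (k < pg F)%nat -> in_int F k x -> in01 x.
Proof.
  intros (_ & Hint & _) Hk Hx; specialize (Hint k Hk).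
  unfold in_int, in01 in *; lra.
Qed.

(* A decreasing branch would attain the supremum [1] of its image at its left
   endpoint. *)
Lemma branch_increasing F k x y : setting F -> (k < pg F)%nat ->
  in_int F k x -> in_int F k y -> x < y -> pf F x < pf F y.
Proof.
  intros (_ & Hint & _ & H01 & Hbr & _) Hk Hx Hy Hxy.
  destruct (Hbr k Hk) as (Hmon & Honto & Hexp).
  specialize (Hint k Hk).
  assert (He := Hexp x y Hx Hy).
  assert (Hne : pf F x <> pf F y).
  { intros E; rewrite E, Rminus_diag, Rabs_R0 in He.
    assert (0 < Rabs (x - y)) by (apply Rabs_pos_lt; lra); lra. }
  destruct Hmon as [Hm|Hm]; [specialize (Hm x y Hx Hy); lra|exfalso].
  assert (Hlo : in_int F k (plo F k)) by (unfold in_int; lra).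
  assert (H0 : in01 (plo F k)) by (unfold in01; lra).
  apply H01 in H0; unfold in01 in H0.
  destruct (Honto ((pf F (plo F k) + 1) / 2)) as (z & Hz & Ez); [unfold in01; lra|].
  assert (pf F z <= pf F (plo F k)) by (apply Hm; auto; apply Hz).
  lra.
Qed.

Lemma cylinder_cons F a w x : setting F ->
  cylinder F (a :: w) x <-> in01 x /\ in_int F a x /\ cylinder F w (pf F x).
Proof.
  intros HF; assert (H01 : forall x, in01 x -> in01 (pf F x)) by apply HF.
  split.
  - intros [H0 H]; split; auto; split; [apply (H 0%nat); simpl; lia|].
    split; auto; intros i Hi; specialize (H (S i) ltac:(simpl; lia)).
    rewrite Nat.iter_succ_r in H; exact H.
  - intros (H0 & Ha & [_ H]); split; auto; intros [|i] Hi; [exact Ha|].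
    rewrite Nat.iter_succ_r; apply H; simpl in Hi; lia.
Qed.

Lemma is_word_cons g a w : is_word g (length (a :: w)) (a :: w) ->
  (a < g)%nat /\ is_word g (length w) w.
Proof. intros [_ H]; inversion H; subst; repeat split; auto. Qed.

Lemma cylinder_increasing F w x y : setting F -> is_word (pg F) (length w) w ->
  cylinder F w x -> cylinder F w y -> x < y ->
  Nat.iter (length w) (pf F) x < Nat.iter (length w) (pf F) y.
Proof.
  intros HF; revert x y; induction w as [|a w IH]; intros x y Hw Hx Hy Hxy; [auto|].
  apply is_word_cons in Hw; destruct Hw as [Ha Hw].
  apply cylinder_cons in Hx, Hy; auto.
  cbn [length]; rewrite !Nat.iter_succ_r; apply IH; try tauto.
  apply branch_increasing with a; tauto.
Qed.

Lemma cylinder_onto F w y : setting F -> is_word (pg F) (length w) w -> in01 y ->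
  exists x, cylinder F w x /\ Nat.iter (length w) (pf F) x = y.
Proof.
  intros HF; induction w as [|a w IH]; intros Hw Hy.
  - exists y; split; auto; split; auto; simpl; lia.
  - apply is_word_cons in Hw; destruct Hw as [Ha Hw].
    destruct (IH Hw Hy) as (z & Hz & Ez).
    assert (HF' := HF); destruct HF' as (_ & _ & _ & _ & Hbr & _).
    destruct (Hbr a Ha) as (_ & Honto & _).
    destruct (Honto z (proj1 Hz)) as (x & Hx & Ex).
    exists x; split.
    + apply cylinder_cons; auto; rewrite Ex; split; auto.
      now apply in_int_in01 with F a.
    + cbn [length]; rewrite Nat.iter_succ_r, Ex; exact Ez.
Qed.

Lemma cylinder_convex F w : setting F -> is_word (pg F) (length w) w ->
  convex_set (cylinder F w).
Proof.
  intros HF; induction w as [|a w IH]; intros Hw x y z Hx Hz Hy.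
  - destruct Hx as [Hx _], Hz as [Hz _]; split; [unfold in01 in *; lra|simpl; lia].
  - apply is_word_cons in Hw; destruct Hw as [Ha Hw].
    apply cylinder_cons in Hx, Hz; auto; apply cylinder_cons; auto.
    destruct Hx as (Hx0 & Hxa & Hx), Hz as (Hz0 & Hza & Hz).
    assert (Hya : in_int F a y) by (unfold in_int in *; lra).
    split; [unfold in01 in *; lra|split; auto].
    apply (IH Hw _ _ _ Hx Hz).
    assert (Hle : forall u v, in_int F a u -> in_int F a v -> u <= v -> pf F u <= pf F v).
    { intros u v Hu Hv [H|<-]; [|lra].
      apply Rlt_le, branch_increasing with a; auto. }
    split; apply Hle; auto; lra.
Qed.

Lemma iter_in01 F n x : setting F -> in01 x -> in01 (Nat.iter n (pf F) x).
Proof.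
  intros (_ & _ & _ & H01 & _) Hx; induction n as [|n IH]; simpl; auto.
Qed.

Lemma coding_exists F x : setting F -> in01 x -> exists c, coding F x c.
Proof.
  intros HF Hx.
  apply (choice (fun i k => (k < pg F)%nat /\ in_int F k (Nat.iter i (pf F) x))).
  intros i; assert (Hi := iter_in01 F i x HF Hx).
  destruct HF as (_ & _ & Hex & _); destruct (Hex _ Hi) as (k & Hk & _); eauto.
Qed.

Lemma digit_unique F x k k' : setting F -> (k < pg F)%nat -> (k' < pg F)%nat ->
  in_int F k x -> in_int F k' x -> k = k'.
Proof.
  intros HF Hk Hk' H H'; assert (Hx := in_int_in01 F k x HF Hk H).
  destruct HF as (_ & _ & Hex & _); destruct (Hex x Hx) as (j & _ & Hj).
  transitivity j; [symmetry|]; apply Hj; auto.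
Qed.

Lemma coding_in01 F x c : setting F -> coding F x c -> in01 x.
Proof.
  intros HF Hc; destruct (Hc 0%nat) as [H1 H2]; now apply in_int_in01 with F (c 0%nat).
Qed.

Lemma prefix_length c n : length (prefix c n) = n.
Proof. unfold prefix; now rewrite length_map, length_seq. Qed.

Lemma prefix_nth c n i : (i < n)%nat -> nth i (prefix c n) 0%nat = c i.
Proof.
  intros Hi; unfold prefix.
  rewrite nth_indep with (d' := c 0%nat) by (rewrite length_map, length_seq; lia).
  rewrite map_nth, seq_nth; auto.
Qed.

Lemma prefix_is_word g c n : (forall i, (c i < g)%nat) ->
  is_word g (length (prefix c n)) (prefix c n).
Proof.
  intros H; split; auto; apply Forall_forall; intros a Ha.
  apply in_map_iff in Ha; destruct Ha as (i & <- & _); auto.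
Qed.

Lemma coding_prefix F x c n : setting F -> coding F x c -> cylinder F (prefix c n) x.
Proof.
  intros HF Hc; split; [now apply coding_in01 with F c|].
  rewrite prefix_length; intros i Hi; rewrite prefix_nth by auto; apply Hc.
Qed.

Lemma coding_agree F c n y c' : setting F -> (forall i, (c i < pg F)%nat) ->
  cylinder F (prefix c n) y -> coding F y c' -> forall i, (i < n)%nat -> c' i = c i.
Proof.
  intros HF Hc [_ Hy] Hc' i Hi.
  specialize (Hy i); rewrite prefix_length, prefix_nth in Hy by auto.
  destruct (Hc' i); eapply digit_unique; eauto.
Qed.

Lemma coding_shift F x c n : coding F x c ->
  coding F (Nat.iter n (pf F) x) (fun i => c (n + i)%nat).
Proof.
  intros Hc i; destruct (Hc (n + i)%nat) as [H1 H2]; split; auto.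
  rewrite Nat.add_comm, Nat.iter_add in H2; rewrite Nat.add_comm; exact H2.
Qed.

(** The iterate is increasing from the cylinder onto [0,1). The preimages of 0 and of the midpoint
    between the image of [x] and 1 lie on the two sides of [x]. *)
Lemma cylinder_interior F w x : setting F -> is_word (pg F) (length w) w ->
  cylinder F w x -> Nat.iter (length w) (pf F) x <> 0 ->
  exists u v, cylinder F w u /\ cylinder F w v /\ u < x < v.
Proof.
  intros HF Hw Hx Hn.
  assert (H01 := iter_in01 F (length w) x HF (proj1 Hx)).
  assert (Hlt : forall y z, cylinder F w y -> cylinder F w z ->
    Nat.iter (length w) (pf F) y < Nat.iter (length w) (pf F) z -> y < z).
  { intros y z Hy Hz Hyz; destruct (Rtotal_order y z) as [?|[->|H]]; auto; [lra|].
    apply (cylinder_increasing F w) in H; auto; lra. }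
  unfold in01 in H01.
  destruct (cylinder_onto F w 0) as (u & Hu & Eu); auto; [unfold in01; lra|].
  destruct (cylinder_onto F w ((Nat.iter (length w) (pf F) x + 1) / 2))
    as (v & Hv & Ev); auto; [unfold in01; lra|].
  exists u, v; split; [auto|split; [auto|]].
  split; apply Hlt; auto; lra.
Qed.

(** * Bounded distortion *)

(** Composing with [clamp] extends a function constantly beyond [[u, v]]. This makes the mean value
    theorem on the whole line applicable to functions with a derivative only relative to a
    cylinder. *)
Definition clamp (u v x : R) : R := Rmax u (Rmin v x).

Lemma clamp_id u v x : u <= x <= v -> clamp u v x = x.
Proof. intros; unfold clamp; rewrite Rmin_right, Rmax_right; lra. Qed.

Lemma clamp_range u v x : u <= v -> u <= clamp u v x <= v.
Proof. unfold clamp, Rmax, Rmin; intros; do 2 destruct Rle_dec; lra. Qed.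

Lemma clamp_lipschitz u v x c : u <= c <= v -> Rabs (clamp u v x - c) <= Rabs (x - c).
Proof.
  unfold clamp, Rmax, Rmin, Rabs; intros; repeat destruct Rle_dec;
    repeat destruct Rcase_abs; lra.
Qed.

Lemma rel_deriv_mvt_lt G S u v : convex_set S ->
  (forall x, S x -> exists l, rel_deriv G S x l) -> S u -> S v -> u < v ->
  exists c l, S c /\ rel_deriv G S c l /\ G v - G u = l * (v - u).
Proof.
  intros HS Hd Hu Hv Huv.
  set (H := fun x => G (clamp u v x)).
  assert (Hin : forall c, u <= c <= v -> S c) by (intros; now apply HS with u v).
  assert (Hcl : forall x, S (clamp u v x)) by (intros; apply Hin, clamp_range; lra).
  assert (Hder : forall c, u < c < v -> forall l, rel_deriv G S c l -> derivable_pt_lim H c l).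
  { intros c Hc l Hl eps Heps; destruct (Hl eps Heps) as (a & Ha & Hla).
    assert (Hm : 0 < Rmin a (Rmin (c - u) (v - c))) by (repeat apply Rmin_glb_lt; lra).
    exists (mkposreal _ Hm); intros h Hh0 Hh; simpl in Hh.
    assert (Hh1 : Rabs h < a) by (eapply Rlt_le_trans; [exact Hh|apply Rmin_l]).
    assert (Hh2 : Rabs h < c - u).
    { eapply Rlt_le_trans; [exact Hh|]; eapply Rle_trans; [apply Rmin_r|apply Rmin_l]. }
    assert (Hh3 : Rabs h < v - c).
    { eapply Rlt_le_trans; [exact Hh|]; eapply Rle_trans; [apply Rmin_r|apply Rmin_r]. }
    apply Rabs_def2 in Hh2, Hh3.
    unfold H; rewrite !clamp_id by lra.
    specialize (Hla (c + h)); simpl in Hla; unfold Rdist in Hla.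
    replace (c + h - c) with h in Hla by lra.
    apply Hla; split; [split; [apply Hin; lra|lra]|auto]. }
  assert (pr1 : forall c, u < c < v -> derivable_pt H c).
  { intros c Hc; destruct (constructive_indefinite_description _ (Hd c ltac:(apply Hin; lra)))
      as [l Hl]; exists l; now apply Hder. }
  destruct (MVT H id u v pr1 (fun c _ => derivable_pt_id c)) as (c & Hc & E); auto.
  (* Continuity on [[u, v]], endpoints included: near [c] the difference quotient of [G] is bounded
     by [Rabs l + 1], and clamping does not increase the distance to [c]. *)
  - intros c Hc eps Heps.
    destruct (Hd c (Hin c Hc)) as [l Hl]; destruct (Hl 1 ltac:(lra)) as (a & Ha & Hla).
    simpl in Hla; unfold Rdist in Hla.
    assert (Hl1 : 0 < Rabs l + 1) by (assert (0 <= Rabs l) by apply Rabs_pos; lra).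
    exists (Rmin a (eps / (Rabs l + 1))); split.
    { apply Rmin_glb_lt; auto; apply Rdiv_lt_0_compat; auto. }
    intros x [_ Hx]; simpl in *; unfold Rdist in *.
    assert (Hx1 : Rabs (x - c) < a) by (eapply Rlt_le_trans; [exact Hx|apply Rmin_l]).
    assert (Hx2 : Rabs (x - c) < eps / (Rabs l + 1))
      by (eapply Rlt_le_trans; [exact Hx|apply Rmin_r]).
    unfold H; rewrite (clamp_id u v c) by auto.
    assert (Hlip := clamp_lipschitz u v x c Hc).
    set (y := clamp u v x) in *.
    destruct (Req_dec y c) as [->|Hy]; [rewrite Rminus_diag, Rabs_R0; auto|].
    assert (Hya : Rabs (y - c) < a) by lra.
    specialize (Hla y (conj (conj (Hcl x) Hy) Hya)).
    assert (Hq : Rabs ((G y - G c) / (y - c)) <= Rabs l + 1).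
    { replace ((G y - G c) / (y - c)) with (((G y - G c) / (y - c) - l) + l) by lra.
      eapply Rle_trans; [apply Rabs_triang|lra]. }
    replace (G y - G c) with ((G y - G c) / (y - c) * (y - c)) by (field; lra).
    rewrite Rabs_mult.
    apply Rle_lt_trans with ((Rabs l + 1) * Rabs (x - c)).
    + apply Rmult_le_compat; auto using Rabs_pos.
    + replace eps with ((Rabs l + 1) * (eps / (Rabs l + 1))) by (field; lra).
      apply Rmult_lt_compat_l; auto.
  - intros; apply derivable_continuous_pt, derivable_pt_id.
  - destruct (Hd c ltac:(apply Hin; lra)) as [l Hl].
    exists c, l; split; [apply Hin; lra|split; auto].
    rewrite (proj2 (derive_pt_eq H c l (pr1 c Hc)) (Hder c Hc l Hl)) in E.
    rewrite derive_pt_id in E; unfold H, id in E.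
    rewrite !clamp_id in E by lra; lra.
Qed.

Lemma rel_deriv_mvt G S u v : convex_set S ->
  (forall x, S x -> exists l, rel_deriv G S x l) -> S u -> S v -> u <> v ->
  exists c l, S c /\ rel_deriv G S c l /\ G v - G u = l * (v - u).
Proof.
  intros HS Hd Hu Hv Huv; destruct (Rtotal_order u v) as [H|[H|H]]; [|lra|].
  - now apply rel_deriv_mvt_lt.
  - destruct (rel_deriv_mvt_lt G S v u) as (c & l & H1 & H2 & H3); auto.
    exists c, l; repeat split; auto; lra.
Qed.

(** Two distinct points in a convex [S] make every [x] of [S] a limit point: move from [x] towards
    [v], or towards [u] when [v <= x]. *)
Lemma rel_deriv_unique G S u v x l l' : convex_set S -> S u -> S v -> u < v -> S x ->
  rel_deriv G S x l -> rel_deriv G S x l' -> l = l'.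
Proof.
  intros HS Hu Hv Huv Hx; apply single_limit.
  intros a Ha; destruct (Rlt_le_dec x v) as [H|H].
  - exists (Rmin v (x + a / 2)).
    assert (H1 : x < Rmin v (x + a / 2) <= x + a / 2)
      by (split; [apply Rmin_glb_lt; lra|apply Rmin_r]).
    assert (H2 := Rmin_l v (x + a / 2)).
    split; [split; [apply HS with x v; auto|]; lra|].
    unfold Rdist; apply Rabs_def1; lra.
  - exists (Rmax u (x - a / 2)).
    assert (H1 : x - a / 2 <= Rmax u (x - a / 2) < x)
      by (split; [apply Rmax_r|apply Rmax_lub_lt; lra]).
    assert (H2 := Rmax_l u (x - a / 2)).
    split; [split; [apply HS with u x; auto|]; lra|].
    unfold Rdist; apply Rabs_def1; lra.
Qed.

(** By the mean value theorem both increments are slope times length, and [cond_i] compares the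
    slopes. The product form also covers coinciding points. *)
Lemma bounded_distortion F : setting F -> cond_i F ->
  exists K, 0 < K /\ forall w, is_word (pg F) (length w) w ->
    forall u v x y, cylinder F w u -> cylinder F w v -> cylinder F w x -> cylinder F w y ->
    Rabs (Nat.iter (length w) (pf F) x - Nat.iter (length w) (pf F) y) * Rabs (u - v)
    <= K * Rabs (x - y)
       * Rabs (Nat.iter (length w) (pf F) u - Nat.iter (length w) (pf F) v).
Proof.
  intros HF (K & HK & Hcond); exists K; split; auto.
  intros w Hw u v x y Hu Hv Hx Hy.
  set (G := Nat.iter (length w) (pf F)) in *.
  assert (Hcv := cylinder_convex F w HF Hw).
  assert (Hd : forall z, cylinder F w z -> exists l, rel_deriv G (cylinder F w) z l).
  { intros z Hz; destruct (Hcond w Hw z z Hz Hz) as (l & _ & H & _); eauto. }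
  destruct (Req_dec x y) as [->|Hxy].
  { rewrite !Rminus_diag, Rabs_R0; lra. }
  destruct (Req_dec u v) as [->|Huv].
  { rewrite !Rminus_diag, Rabs_R0; lra. }
  destruct (rel_deriv_mvt G _ y x Hcv Hd Hy Hx ltac:(auto)) as (c & l & Sc & Dc & ->).
  destruct (rel_deriv_mvt G _ v u Hcv Hd Hv Hu ltac:(auto)) as (c' & l' & Sc' & Dc' & ->).
  destruct (Hcond w Hw c c' Sc Sc') as (m & m' & Hm & Hm' & Hlt).
  assert (Hun : forall z k k', cylinder F w z -> rel_deriv G (cylinder F w) z k ->
     rel_deriv G (cylinder F w) z k' -> k = k').
  { intros z k k' Hz; destruct (Rtotal_order u v) as [H|[H|H]]; [|lra|].
    - apply rel_deriv_unique with u v; auto.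
    - apply rel_deriv_unique with v u; auto. }
  (* The derivatives supplied by [cond_i] are identified with the mean value slopes by
     uniqueness. *)
  rewrite <- (Hun c l m), <- (Hun c' l' m') in Hlt; auto.
  rewrite !Rabs_mult.
  assert (0 <= Rabs (x - y) * Rabs (u - v)) by (apply Rmult_le_pos; apply Rabs_pos).
  apply Rle_trans with (Rabs l * (Rabs (x - y) * Rabs (u - v))); [lra|].
  apply Rle_trans with ((K * Rabs l') * (Rabs (x - y) * Rabs (u - v))); [|lra].
  apply Rmult_le_compat_r; lra.
Qed.

Lemma uniform_bound (P : nat -> R -> Prop) g :
  (forall k B B', P k B -> B <= B' -> P k B') ->
  (forall k, (k < g)%nat -> exists B, P k B) ->
  exists B, 0 < B /\ forall k, (k < g)%nat -> P k B.
Proof.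
  intros Hmon; induction g as [|g IH]; intros H.
  - exists 1; split; [lra|lia].
  - destruct IH as (B & HB & HBk); [intros; apply H; lia|].
    destruct (H g) as [B' HB']; [lia|].
    exists (Rmax B B'); split; [apply Rlt_le_trans with B; auto; apply Rmax_l|].
    intros k Hk; destruct (Nat.eq_dec k g) as [->|Hne].
    + apply Hmon with B'; auto; apply Rmax_r.
    + apply Hmon with B; [apply HBk; lia|apply Rmax_l].
Qed.

(** Distortion on a one-letter cylinder is measured against a fixed pair, the left endpoint and the
    midpoint, whose images are at most 1 apart. The largest constant over the finitely many branches
    is taken. *)
Lemma branch_lipschitz F : setting F -> cond_i F ->
  exists B, 0 < B /\ forall k, (k < pg F)%nat -> forall x y, in_int F k x -> in_int F k y ->
    Rabs (pf F x - pf F y) <= B * Rabs (x - y).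
Proof.
  intros HF Hi; destruct (bounded_distortion F HF Hi) as (K & HK & Hdist).
  apply uniform_bound.
  - intros k B B' HB Hle x y Hx Hy; eapply Rle_trans; [now apply HB|].
    apply Rmult_le_compat_r; auto using Rabs_pos.
  - intros k Hk.
    assert (Hlo : 0 <= plo F k < phi F k /\ phi F k <= 1) by now apply HF.
    assert (Hcyl : forall x, in_int F k x -> cylinder F [k] x).
    { intros x Hx; apply cylinder_cons; auto; split; [now apply in_int_in01 with F k|].
      split; auto; split; [|simpl; lia].
      now apply (iter_in01 F 1), in_int_in01 with F k. }
    set (u := plo F k); set (v := (plo F k + phi F k) / 2).
    assert (Huv : 0 < Rabs (u - v)) by (apply Rabs_pos_lt; unfold u, v; lra).
    exists (K / Rabs (u - v)); intros x y Hx Hy.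
    assert (Hw : is_word (pg F) 1 [k]) by (split; auto).
    assert (H := Hdist [k] Hw u v x y ltac:(apply Hcyl; unfold in_int, u; lra)
      ltac:(apply Hcyl; unfold in_int, v; lra) (Hcyl x Hx) (Hcyl y Hy)).
    simpl in H.
    assert (H1 : Rabs (pf F u - pf F v) <= 1).
    { assert (Hu : in01 (pf F u)) by (apply HF; unfold in01, u; lra).
      assert (Hv : in01 (pf F v)) by (apply HF; unfold in01, v; lra).
      unfold in01 in *; apply Rabs_le; lra. }
    apply Rmult_le_reg_r with (Rabs (u - v)); auto.
    apply Rle_trans with (1 := H).
    replace (K / Rabs (u - v) * Rabs (x - y) * Rabs (u - v)) with (K * Rabs (x - y) * 1)
      by (field; lra).
    apply Rmult_le_compat_l; auto.
    apply Rmult_le_pos; auto using Rabs_pos; lra.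
Qed.

(* The cylinder is the first one around the midpoint of [I] that is shorter
   than half of [I]. *)
Lemma node_contains_cylinder F : setting F -> cond_i F ->
  exists A, 0 < A /\ forall I : node, exists w, is_word (pg F) (length w) w /\
    (forall x, cylinder F w x -> inD I x) /\
    forall x y, cylinder F w x -> cylinder F w y ->
      Rabs (Nat.iter (length w) (pf F) x - Nat.iter (length w) (pf F) y)
      <= A / dlen I * Rabs (x - y).
Proof.
  intros HF Hi.
  destruct (bounded_distortion F HF Hi) as (K & HK & Hdist).
  destruct (branch_lipschitz F HF Hi) as (B & HB & Hlip).
  (* The parent cylinder has two points at distance at least [dlen I / 2], so distortion gives the
     factor [2 * K / dlen I] there; the last branch adds the factor [B]. *)
  exists (2 * K * B); split; [repeat apply Rmult_lt_0_compat; lra|].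
  intros I; assert (HI := dlen_pos I); assert (HI1 := dlen_le1 I).
  set (x0 := dleft I + dlen I / 2).
  assert (Hx0 : in01 x0) by (apply (inD_in01 I); unfold inD, x0; lra).
  destruct (coding_exists F x0 HF Hx0) as [c Hc].
  assert (Hcg : forall i, (c i < pg F)%nat) by apply Hc.
  set (small := fun n => forall u v, cylinder F (prefix c n) u ->
    cylinder F (prefix c n) v -> Rabs (u - v) < dlen I / 2).
  assert (HN : exists N, small N).
  { assert (HF' := HF); destruct HF' as (_ & _ & _ & _ & _ & Hdiam).
    destruct (Hdiam c Hcg (dlen I / 2) ltac:(lra)) as [N HN].
    exists N; unfold small; apply (HN N (le_n _)). }
  assert (H0 : ~ small 0%nat).
  { intros H; specialize (H 0 (/ 2)).
    assert (Hin : forall z, in01 z -> cylinder F (prefix c 0) z)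
      by (split; auto; simpl; lia).
    specialize (H (Hin 0 ltac:(unfold in01; lra)) (Hin (/2) ltac:(unfold in01; lra))).
    rewrite Rabs_left in H; lra. }
  assert (Hn : exists n, ~ small n /\ small (S n)).
  { destruct HN as [N HN]; induction N as [|N IH]; [tauto|].
    destruct (classic (small N)); eauto. }
  destruct Hn as (n & Hn1 & Hn2).
  exists (prefix c (S n)); split; [now apply prefix_is_word|split].
  - intros x Hx.
    assert (H := Hn2 x x0 Hx (coding_prefix F x0 c _ HF Hc)).
    apply Rabs_def2 in H; unfold x0, inD in *; lra.
  - assert (Huv : exists u v, cylinder F (prefix c n) u /\ cylinder F (prefix c n) v /\
        dlen I / 2 <= Rabs (u - v)).
    { apply NNPP; intros Hno; apply Hn1; intros u v Hu Hv.
      apply Rnot_le_lt; intros Hle; apply Hno; eauto. }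
    destruct Huv as (u & v & Hu & Hv & Huv).
    assert (Hsub : forall x, cylinder F (prefix c (S n)) x ->
        cylinder F (prefix c n) x /\ in_int F (c n) (Nat.iter n (pf F) x)).
    { intros x [Hx H]; rewrite prefix_length in H; split.
      - split; auto; rewrite prefix_length; intros i Hi'.
        specialize (H i ltac:(lia)); rewrite prefix_nth in * by lia; auto.
      - specialize (H n ltac:(lia)); rewrite prefix_nth in H by lia; auto. }
    intros x y Hx Hy; apply Hsub in Hx, Hy.
    rewrite prefix_length; simpl.
    assert (H := Hdist _ (prefix_is_word _ c n Hcg) u v x y Hu Hv (proj1 Hx) (proj1 Hy)).
    rewrite prefix_length in H.
    assert (H1 : Rabs (Nat.iter n (pf F) u - Nat.iter n (pf F) v) <= 1).
    { assert (P := iter_in01 F n u HF (proj1 Hu)); assert (Q := iter_in01 F n v HF (proj1 Hv)).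
      unfold in01 in *; apply Rabs_le; lra. }
    assert (H2 : Rabs (Nat.iter n (pf F) x - Nat.iter n (pf F) y)
                 <= 2 * K / dlen I * Rabs (x - y)).
    { apply Rmult_le_reg_r with (dlen I / 2); [lra|].
      replace (2 * K / dlen I * Rabs (x - y) * (dlen I / 2)) with (K * Rabs (x - y) * 1)
        by (field; lra).
      eapply Rle_trans; [apply Rmult_le_compat_l; [apply Rabs_pos|exact Huv]|].
      apply Rle_trans with (1 := H); apply Rmult_le_compat_l; auto.
      apply Rmult_le_pos; auto using Rabs_pos; lra. }
    eapply Rle_trans; [apply (Hlip (c n)); [apply Hcg|apply Hx|apply Hy]|].
    replace (2 * K * B / dlen I * Rabs (x - y)) with (B * (2 * K / dlen I * Rabs (x - y)))
      by (field; lra).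
    apply Rmult_le_compat_l; lra.
Qed.

(** * Frequencies *)

Lemma forallb_ext_in {A} (f g : A -> bool) l :
  (forall x, In x l -> f x = g x) -> forallb f l = forallb g l.
Proof.
  induction l as [|a l IH]; intros H; simpl; auto.
  rewrite (H a), IH; auto; [intros; apply H; now right|now left].
Qed.

Lemma freq_ext c c' w k : (forall i, (i < k + length w + 1)%nat -> c i = c' i) ->
  freq c w k = freq c' w k.
Proof.
  intros H; unfold freq, tau; do 3 f_equal.
  apply filter_ext_in; intros j Hj; apply in_seq in Hj.
  apply forallb_ext_in; intros l Hl; apply in_seq in Hl.
  rewrite H; auto; lia.
Qed.

Lemma tau_shift c w k :
  tau c w (S k + length w + 1) =
  ((if matchb c w 0 then 1 else 0) + tau (fun i => c (S i)) w (k + length w + 1))%nat.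
Proof.
  unfold tau.
  replace (S k + length w + 1 - length w)%nat with (S (S k)) by lia.
  replace (k + length w + 1 - length w)%nat with (S k) by lia.
  change (seq 0 (S (S k))) with (0%nat :: seq 1 (S k)).
  rewrite <- seq_shift; cbn [filter].
  assert (E : length (filter (matchb c w) (map S (seq 0 (S k)))) =
              length (filter (matchb (fun i => c (S i)) w) (seq 0 (S k)))).
  { generalize (seq 0 (S k)) as l; induction l as [|j l IH]; auto.
    simpl; change (matchb c w (S j)) with (matchb (fun i => c (S i)) w j).
    destruct matchb; simpl; now rewrite IH. }
  destruct (matchb c w 0); cbn [length]; rewrite E; reflexivity.
Qed.

Lemma freq_range c w k : 0 <= freq c w k <= 1.
Proof.
  assert (Hk : 0 < INR (k + 1)) by (apply lt_0_INR; lia).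
  assert (H : (tau c w (k + length w + 1) <= k + 1)%nat).
  { unfold tau; eapply Nat.le_trans; [apply filter_length_le|].
    rewrite length_seq; lia. }
  apply le_INR in H; assert (H0 := pos_INR (tau c w (k + length w + 1))).
  unfold freq; split.
  - apply Rmult_le_pos; auto; now apply Rlt_le, Rinv_0_lt_compat.
  - apply Rmult_le_reg_r with (INR (k + 1)); auto; field_simplify; lra.
Qed.

(** For the two frequencies [a], [b] and [n = S k], the product [(a - b) * (n + 1)] is the indicator
    of a match at position 0 minus [b], hence at most 1 in absolute value. *)
Lemma freq_shift_close c w k :
  Rabs (freq c w (S k) - freq (fun i => c (S i)) w k) <= / INR (S k).
Proof.
  assert (Hr := freq_range (fun i => c (S i)) w k).
  assert (E : freq c w (S k) * (INR (S k) + 1) =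
    (if matchb c w 0 then 1 else 0) + freq (fun i => c (S i)) w k * INR (S k)).
  { unfold freq; rewrite tau_shift, plus_INR.
    rewrite !Nat.add_1_r, (S_INR (S k)).
    assert (0 < INR (S k)) by (apply lt_0_INR; lia).
    destruct (matchb c w 0); rewrite ?INR_0, ?INR_1; field; lra. }
  assert (Hk : 0 < INR (S k)) by (apply lt_0_INR; lia).
  set (a := freq c w (S k)) in *; set (b := freq (fun i => c (S i)) w k) in *.
  set (n := INR (S k)) in *.
  assert (Hab : (a - b) * (n + 1) = (if matchb c w 0 then 1 else 0) - b) by lra.
  assert (H1 : Rabs ((a - b) * (n + 1)) <= 1).
  { rewrite Hab; destruct (matchb c w 0); apply Rabs_le; lra. }
  rewrite Rabs_mult, (Rabs_right (n + 1)) in H1 by lra.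
  apply Rmult_le_reg_r with n; auto; rewrite Rinv_l by lra.
  assert (H2 := Rabs_pos (a - b)); nra.
Qed.

Lemma freq_cv_tail c w n v : Un_cv (freq (fun i => c (n + i)%nat) w) v ->
  Un_cv (freq c w) v.
Proof.
  revert c; induction n as [|n IH]; intros c H; [exact H|].
  assert (H' : Un_cv (freq (fun i => c (S i)) w) v) by (apply IH; exact H).
  clear H; intros eps He.
  destruct (H' (eps / 2)) as [N HN]; [lra|].
  destruct (INR_unbounded (2 / eps)) as [M HM].
  exists (S (N + M)); intros [|k] Hk; [lia|].
  specialize (HN k ltac:(lia)).
  assert (H1 := freq_shift_close c w k).
  assert (H2 : / INR (S k) < eps / 2).
  { assert (2 / eps < INR (S k)) by (eapply Rlt_trans; [exact HM|apply lt_INR; lia]).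
    replace (eps / 2) with (/ (2 / eps)) by (field; lra).
    apply Rinv_lt_contravar; auto.
    assert (0 < 2 / eps) by (apply Rdiv_lt_0_compat; lra).
    apply Rmult_lt_0_compat; lra. }
  unfold Rdist in *.
  replace (freq c w (S k) - v) with
    ((freq c w (S k) - freq (fun i => c (S i)) w k) + (freq (fun i => c (S i)) w k - v)) by lra.
  eapply Rle_lt_trans; [apply Rabs_triang|lra].
Qed.

(** [N] bounds both the time and the precision, so that lying in [visits] for all [N] makes [v] a
    cluster value of the frequencies. *)
Definition visits (F : PMap) (w : list nat) (v : R) (N : nat) (x : R) : Prop :=
  in01 x /\ forall c, coding F x c ->
    exists k, (N <= k)%nat /\ Rabs (freq c w k - v) < / INR (N + 1).

(** A visit at time [k] is decided by finitely many digits, hence shared by a whole cylinder; as the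
    iterate of [x] is not 0, [x] is interior to it. *)
Lemma interior_visits F w v N n x c : setting F -> coding F x c ->
  Un_cv (freq (fun i => c (n + i)%nat) w) v ->
  (forall k, Nat.iter (k + n) (pf F) x <> 0) ->
  interior (visits F w v N) x.
Proof.
  intros HF Hc Hcv Hne.
  apply freq_cv_tail in Hcv.
  assert (HN : 0 < / INR (N + 1)) by (apply Rinv_0_lt_compat, lt_0_INR; lia).
  destruct (Hcv _ HN) as [M HM].
  (* [M] gives the precision and [N] the lateness; [n] makes the prefix long enough for the
     hypothesis on iterates. *)
  set (k := (M + N + n)%nat).
  specialize (HM k ltac:(unfold k; lia)).
  set (len := (k + length w + 1)%nat).
  assert (Hcg : forall i, (c i < pg F)%nat) by apply Hc.
  assert (Hw := prefix_is_word (pg F) c len Hcg).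
  destruct (cylinder_interior F (prefix c len) x HF Hw (coding_prefix F x c len HF Hc))
    as (a & b & Ha & Hb & Hab).
  { rewrite prefix_length; unfold len, k.
    replace (M + N + n + length w + 1)%nat with (M + N + length w + 1 + n)%nat by lia.
    apply Hne. }
  assert (Hd : 0 < Rmin (x - a) (b - x)) by (apply Rmin_glb_lt; lra).
  exists (mkposreal _ Hd); intros y Hy; unfold disc in Hy; simpl in Hy.
  assert (H1 := Rmin_l (x - a) (b - x)); assert (H2 := Rmin_r (x - a) (b - x)).
  apply Rabs_def2 in Hy.
  assert (Cy : cylinder F (prefix c len) y).
  { apply (cylinder_convex F _ HF Hw a y b); auto; lra. }
  split; [apply Cy|intros c' Hc'].
  exists k; split; [unfold k; lia|].
  rewrite (freq_ext c' c); [exact HM|].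
  intros i Hi; now apply (coding_agree F c len y).
Qed.

(** * Enumerations *)

(** The binary digits after the leading 1 give a bijection between positive numbers and nodes. *)
Fixpoint node_of_positive (p : positive) : node :=
  match p with
  | xH => []
  | xO q => false :: node_of_positive q
  | xI q => true :: node_of_positive q
  end.

Definition node_of_nat (n : nat) : node := node_of_positive (Pos.of_succ_nat n).

Lemma node_of_nat_injective : Injective node_of_nat.
Proof.
  assert (H : forall p q, node_of_positive p = node_of_positive q -> p = q).
  { induction p as [p IH|p IH|]; intros [q|q|] E; simpl in E; try discriminate; auto;
      injection E as E; f_equal; auto. }
  intros n m E; apply SuccNat2Pos.inj, H, E.
Qed.

Lemma node_of_nat_surjective I : exists n, node_of_nat n = I.
Proof.
  assert (H : exists p, node_of_positive p = I).
  { induction I as [|b I [p <-]]; [now exists xH|].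
    destruct b; [now exists (xI p)|now exists (xO p)]. }
  destruct H as [p <-]; exists (Nat.pred (Pos.to_nat p)); unfold node_of_nat; f_equal.
  apply SuccNat2Pos.inv; assert (Hp := Pos2Nat.is_pos p); lia.
Qed.

Fixpoint word_of_code (len code : nat) : list nat :=
  match len with
  | O => []
  | S l => fst (Cantor.of_nat code) :: word_of_code l (snd (Cantor.of_nat code))
  end.

Definition word_of_nat (n : nat) : list nat :=
  word_of_code (fst (Cantor.of_nat n)) (snd (Cantor.of_nat n)).

Lemma word_of_nat_surjective w : exists n, word_of_nat n = w.
Proof.
  assert (H : exists c, word_of_code (length w) c = w).
  { induction w as [|a w [c IH]]; [now exists 0%nat|].
    exists (Cantor.to_nat (a, c)); cbn [length word_of_code].
    rewrite Cantor.cancel_of_to; simpl; now rewrite IH. }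
  destruct H as [c Hc]; exists (Cantor.to_nat (length w, c)).
  unfold word_of_nat; rewrite Cantor.cancel_of_to; exact Hc.
Qed.

Lemma countable_preimages_of_zero F : setting F ->
  exists e : nat -> R, forall y, in01 y ->
    (exists n, Nat.iter n (pf F) y = 0) -> exists i, e i = y.
Proof.
  intros HF.
  destruct (choice (fun i x => let w := word_of_nat i in is_word (pg F) (length w) w ->
    forall y, cylinder F w y -> Nat.iter (length w) (pf F) y = 0 -> x = y)) as [e He].
  - intros i; cbv zeta; set (w := word_of_nat i).
    destruct (classic (is_word (pg F) (length w) w)) as [Hw|Hw]; [|exists 0; tauto].
    destruct (cylinder_onto F w 0 HF Hw) as (x & Hx & Ex); [unfold in01; lra|].
    exists x; intros _ y Hy Ey.
    destruct (Rtotal_order x y) as [H|[H|H]]; auto;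
      apply (cylinder_increasing F w) in H; auto; lra.
  - exists e; intros y Hy [n Hn].
    destruct (coding_exists F y HF Hy) as [c Hc].
    destruct (word_of_nat_surjective (prefix c n)) as [i Hi].
    exists i; specialize (He i); cbv zeta in He; rewrite Hi in He; apply He.
    + apply prefix_is_word, Hc.
    + now apply coding_prefix.
    + now rewrite prefix_length.
Qed.

Lemma lsum_filter {A} (P : A -> Prop) (w : A -> R) l :
  lsum (fun x => if excluded_middle_informative (P x) then w x else 0) l =
  lsum w (filter (fun x => if excluded_middle_informative (P x) then true else false) l).
Proof.
  induction l as [|a l IH]; [reflexivity|].
  rewrite lsum_cons; cbn [filter]; destruct excluded_middle_informative;
    rewrite ?lsum_cons, IH; lra.
Qed.

(** * The dimension of the divergent set *)

(** The expansion of the image of [x] is a tail of that of [x], so both have the same limiting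
    frequencies. *)
Lemma Gset_pullback F w m p N w0 x : setting F -> is_word (pg F) m w ->
  is_word (pg F) (length w0) w0 -> cylinder F w0 x ->
  Gset F m p (Nat.iter (length w0) (pf F) x) ->
  (forall k, Nat.iter k (pf F) (Nat.iter (length w0) (pf F) x) <> 0) ->
  interior (visits F w (p w) N) x.
Proof.
  intros HF Hw Hw0 Hx [_ (cy & Hcy & Hcv)] Hne.
  destruct (coding_exists F x HF (proj1 Hx)) as [c Hc].
  apply interior_visits with (n := length w0) (c := c); auto.
  - assert (Hs := coding_shift F x c (length w0) Hc).
    intros eps He; destruct (Hcv w Hw eps He) as [M HM].
    exists M; intros k Hk; rewrite (freq_ext _ cy); [now apply HM|].
    intros i _; destruct (Hcy i), (Hs i); eapply digit_unique; eauto.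
  - intros k; rewrite Nat.iter_add; apply Hne.
Qed.

(** By contraposition: nodes of [T] inside [I] that are too cheap are carried to a cover of [Gset],
    up to preimages of 0, by the iterate on a cylinder in [I], which expands by at most
    [A / dlen I]. *)
Lemma heavy_visits F w m p s N : 0 < s -> setting F -> cond_i F -> is_word (pg F) m w ->
  ~ Hnull s (Gset F m p) ->
  exists c, 0 < c /\ heavy (Rpower (/2) s) c (interior (visits F w (p w) N)).
Proof.
  intros Hs HF Hi Hw HG.
  apply not_all_ex_not in HG; destruct HG as [eps HG].
  apply imply_to_and in HG; destruct HG as [He HG].
  destruct (node_contains_cylinder F HF Hi) as (A & HA & Hcyl).
  destruct (countable_preimages_of_zero F HF) as [e He0].
  set (rho := Rpower (/2) s); set (a := Rpower A s).
  assert (Hrho : 0 < rho) by apply Rpower_pos.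
  assert (Ha : 0 < a) by apply Rpower_pos.
  (* No cover of [Gset] costs at most [eps]. Half of it is reserved for the exceptional points and
     idle indices, and [a] is the price of the factor [A] in the diameters. *)
  exists (eps / 2 / a); split; [repeat apply Rdiv_lt_0_compat; lra|].
  intros I T HT.
  destruct (classic (exists J, T J /\ below I J)) as [?|Hno]; [now left|right].
  apply NNPP; intros Hlight; apply HG; clear HG.
  destruct (Hcyl I) as (w0 & Hw0 & Hsub & Hlip).
  set (f := Nat.iter (length w0) (pf F)) in *.
  set (act := fun i => T (node_of_nat i) /\ below (node_of_nat i) I).
  assert (HI := dlen_pos I).
  apply cover_up_to_countable with (A := act) (e := e)
    (U := fun i y => exists x, cylinder F w0 x /\ inD (node_of_nat i) x /\ f x = y)
    (r := fun i => A / dlen I * dlen (node_of_nat i)); auto.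
  - intros y Hy.
    destruct (classic (exists n, Nat.iter n (pf F) y = 0)) as [Hz|Hz].
    { right; apply He0; auto; apply Hy. }
    left; destruct (cylinder_onto F w0 y HF Hw0 (proj1 Hy)) as (x & Hx & Ex).
    assert (Ix := Hsub x Hx).
    destruct (HT x) as (J & TJ & Jx); auto.
    { apply Gset_pullback with m w0; auto; rewrite Ex; auto.
      intros k Hk; apply Hz; eauto. }
    (* Both nodes contain [x], and by [Hno] the node [J] does not contain [I]. *)
    assert (HJ : below J I).
    { destruct (inD_comparable J I x Jx Ix) as [?|?]; auto; exfalso; eauto. }
    destruct (node_of_nat_surjective J) as [i <-].
    exists i; split; [split; auto|exists x; auto].
  - intros i _; assert (HJ := dlen_pos (node_of_nat i)).
    assert (HAI : 0 < A / dlen I) by (apply Rdiv_lt_0_compat; auto).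
    split; [now apply Rmult_lt_0_compat|].
    intros y z (x & Cx & Jx & <-) (x' & Cx' & Jx' & <-).
    eapply Rle_trans; [now apply Hlip|].
    apply Rmult_le_compat_l; [lra|]; now apply (inD_dist (node_of_nat i)).
  - intros M; rewrite lsum_filter.
    set (l := filter _ (seq 0 M)).
    assert (Hl : lsum (fun J => rho ^ length J) (map node_of_nat l)
                 < eps / 2 / a * rho ^ length I).
    { apply Rnot_le_lt; intros Hle; apply Hlight.
      exists (map node_of_nat l); split; [|split; auto].
      - apply Injective_map_NoDup; [apply node_of_nat_injective|].
        apply NoDup_filter, seq_NoDup.
      - intros J HJ; apply in_map_iff in HJ; destruct HJ as (i & <- & HJ).
        apply filter_In in HJ; destruct HJ as [_ HJ].
        destruct excluded_middle_informative as [h|h]; [exact h|discriminate]. }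
    assert (HrI : 0 < rho ^ length I) by now apply pow_lt.
    assert (E : forall i, Rpower (A / dlen I * dlen (node_of_nat i)) s =
        a / rho ^ length I * rho ^ length (node_of_nat i)).
    { intros i; unfold rho; rewrite <- !Rpower_half_pow; fold (dlen I).
      fold (dlen (node_of_nat i)).
      unfold Rdiv; rewrite <- !Rpower_mult_distr, Rpower_inv; auto using dlen_pos.
      - now apply Rinv_0_lt_compat.
      - apply Rmult_lt_0_compat; auto; now apply Rinv_0_lt_compat. }
    eapply Rle_trans.
    { apply lsum_le with (w' := fun i => a / rho ^ length I * rho ^ length (node_of_nat i)).
      intros i _; rewrite E; apply Rle_refl. }
    rewrite lsum_scal; rewrite lsum_map in Hl.
    apply Rlt_le.
    replace (eps / 2) with (a / rho ^ length I * (eps / 2 / a * rho ^ length I))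
      by (field; lra).
    apply Rmult_lt_compat_l; auto; now apply Rdiv_lt_0_compat.
Qed.

Lemma two_frequencies F w s : 0 < s < 1 -> setting F -> cond_i F -> cond_ii F ->
  (1 <= length w)%nat -> is_word (pg F) (length w) w ->
  exists v v', v <> v' /\ forall N,
    heavy (Rpower (/2) s) 1 (interior (visits F w v N)) /\
    heavy (Rpower (/2) s) 1 (interior (visits F w v' N)).
Proof.
  intros Hs HF Hi Hii Hlen Hw.
  destruct (Hii (length w) Hlen) as (p & _ & [Hp _] & Hq).
  (* With [delta = 1 - s] the second set has dimension above [s], so neither set is [s]-null. *)
  destruct (Hq w Hw (1 - s)) as (q & _ & Hne & d & [Hd _] & Hgt); [lra|].
  assert (Hrho : / 2 < Rpower (/2) s) by (apply Rpower_half_gt_half; lra).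
  exists (p w), (q w); split; [auto|].
  intros N; split.
  - destruct (heavy_visits F w (length w) p s N) as (c & Hc & H); auto; [lra| |].
    + intros Hn; apply Hp in Hn; lra.
    + now apply heavy_one with c.
  - destruct (heavy_visits F w (length w) q s N) as (c & Hc & H); auto; [lra| |].
    + intros Hn; apply Hd in Hn; lra.
    + now apply heavy_one with c.
Qed.

Lemma interior_mono (V W : R -> Prop) x :
  (forall y, V y -> W y) -> interior V x -> interior W x.
Proof. intros H [d Hd]; exists d; intros y Hy; apply H, Hd, Hy. Qed.

Lemma visits_limit F w v L c x : coding F x c -> (forall N, visits F w v N x) ->
  Un_cv (freq c w) L -> L = v.
Proof.
  intros Hc Hv HL; apply NNPP; intros Hne.
  assert (He : 0 < Rabs (L - v)) by (apply Rabs_pos_lt; lra).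
  destruct (HL (Rabs (L - v) / 2)) as [M HM]; [lra|].
  destruct (INR_unbounded (2 / Rabs (L - v))) as [N HN].
  (* The index [M + N] makes the visit both late enough for [M] and closer to [v] than half the gap
     between [L] and [v]. *)
  destruct (proj2 (Hv (M + N)%nat) c Hc) as (k & Hk & Hfk).
  specialize (HM k ltac:(lia)); unfold Rdist in HM.
  assert (H : / INR (M + N + 1) < Rabs (L - v) / 2).
  { replace (Rabs (L - v) / 2) with (/ (2 / Rabs (L - v))) by (field; lra).
    assert (0 < 2 / Rabs (L - v)) by (apply Rdiv_lt_0_compat; lra).
    assert (2 / Rabs (L - v) < INR (M + N + 1))
      by (eapply Rlt_le_trans; [exact HN|apply le_INR; lia]).
    apply Rinv_lt_contravar; auto; apply Rmult_lt_0_compat; lra. }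
  assert (Ht := Rabs_triang (L - freq c w k) (freq c w k - v)).
  rewrite (Rabs_minus_sym L (freq c w k)) in Ht.
  replace (L - freq c w k + (freq c w k - v)) with (L - v) in Ht by lra; lra.
Qed.

Lemma divergent_set_not_null (fs : nat -> PMap) s :
  (forall i, setting (fs i) /\ cond_i (fs i) /\ cond_ii (fs i)) ->
  0 < s < 1 -> ~ Hnull s (divergent_set fs).
Proof.
  intros Hfs Hs Hnull.
  set (rho := Rpower (/2) s).
  assert (Hrho : 0 < rho) by apply Rpower_pos.
  set (legit := fun i w => (1 <= length w)%nat /\ is_word (pg (fs i)) (length w) w).
  destruct (choice (fun (iw : nat * list nat) (v : R * R) =>
    legit (fst iw) (snd iw) -> fst v <> snd v /\ forall N,
      heavy rho 1 (interior (visits (fs (fst iw)) (snd iw) (fst v) N)) /\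
      heavy rho 1 (interior (visits (fs (fst iw)) (snd iw) (snd v) N)))) as [val Hval].
  { intros [i w]; destruct (classic (legit i w)) as [[Hl Hw]|Hl].
    - destruct (Hfs i) as (HF & Hi & Hii).
      destruct (two_frequencies (fs i) w s Hs HF Hi Hii Hl Hw) as (v & v' & H).
      exists (v, v'); auto.
    - exists (0, 0); simpl; tauto. }
  (* One index encodes a map, a word, the choice between its two values, and [N]. *)
  set (V := fun n x =>
    let '(i, n1) := Cantor.of_nat n in let '(u, n2) := Cantor.of_nat n1 in
    let '(b, N) := Cantor.of_nat n2 in let w := word_of_nat u in
    legit i w ->
    visits (fs i) w (if Nat.eqb b 0 then fst (val (i, w)) else snd (val (i, w))) N x).
  assert (HV : forall n, heavy rho 1 (interior (V n))).
  (* If the decoded list is not an admissible word, [V n] is the whole line; it inherits heaviness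
     from any heavy set, such as one for the word [[0]] of the first map. *)
  { assert (Hany : exists W, heavy rho 1 (interior W)).
    { exists (visits (fs 0%nat) [0%nat] (fst (val (0%nat, [0%nat]))) 0).
      apply (Hval (0%nat, [0%nat])); split; simpl; auto; split; auto.
      constructor; auto; destruct (Hfs 0%nat) as [[H _] _]; lia. }
    intros n; unfold V.
    destruct (Cantor.of_nat n) as [i n1], (Cantor.of_nat n1) as [u n2],
      (Cantor.of_nat n2) as [b N]; cbv zeta; set (w := word_of_nat u).
    destruct (classic (legit i w)) as [Hl|Hl].
    - destruct (proj2 (Hval (i, w) Hl) N) as [H1 H2].
      destruct (Nat.eqb b 0).
      + apply heavy_subset with (2 := H1); intros x; apply interior_mono; auto.
      + apply heavy_subset with (2 := H2); intros x; apply interior_mono; auto.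
    - destruct Hany as [W HW]; apply heavy_subset with (2 := HW).
      intros x; apply interior_mono; tauto. }
  destruct (Hnull_node_cover s _ (proj1 Hs) Hnull) as (S & HSc & HSs).
  destruct (point_outside_cover rho S V HV) as (x & Hx & Vx & Sx).
  (* The root costs 1, so a family of cost below 1 cannot contain it; the game may start there. *)
  { split.
    - intros J SJ [l Hl].
      assert (J = []) by (destruct l, J; simpl in Hl; congruence); subst J.
      specialize (HSs [[]] ltac:(repeat constructor; simpl; tauto)).
      unfold lsum in HSs; simpl in HSs.
      assert (1 + 0 < 1); [apply HSs|lra].
      intros J [<-|[]]; auto.
    - intros l Hnd Hl; apply HSs; auto; intros J HJ; now apply Hl. }
  destruct (HSc x Hx) as (J & SJ & Jx); [|now apply (Sx J)].
  split; auto; intros i; destruct (Hfs i) as (HF & _ & _).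
  destruct (coding_exists (fs i) x HF Hx) as [c Hc].
  exists c; split; auto; intros m Hm w Hw [L HL].
  assert (Hl : legit i w).
  { destruct Hw as [<- Hw]; split; auto; split; auto. }
  assert (Hall : forall b N, visits (fs i) w
     (if Nat.eqb b 0 then fst (val (i, w)) else snd (val (i, w))) N x).
  { intros b N; destruct (word_of_nat_surjective w) as [u Hu].
    specialize (Vx (Cantor.to_nat (i, Cantor.to_nat (u, Cantor.to_nat (b, N))))).
    unfold V in Vx; rewrite !Cantor.cancel_of_to in Vx; cbv zeta in Vx.
    rewrite Hu in Vx; auto. }
  (* A limit of the frequencies would equal both chosen values, which differ. *)
  apply (proj1 (Hval (i, w) Hl)); cbn [fst snd] in *.
  rewrite <- (visits_limit _ _ _ L c x Hc (Hall 0%nat) HL).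
  exact (visits_limit _ _ _ L c x Hc (Hall 1%nat) HL).
Qed.

Theorem mainTheorem2 (fs : nat -> PMap) :
  (forall i, setting (fs i) /\ cond_i (fs i) /\ cond_ii (fs i)) ->
  is_hdim (divergent_set fs) 1.
Proof.
  intros Hfs; split.
  - intros s Hs Hn; apply Rnot_lt_le; intros Hlt.
    now apply (divergent_set_not_null fs s).
  - intros t Ht; apply Rnot_lt_le; intros Hlt.
    (* If [t] exceeded 1, the midpoint of 1 and [t] would be an exponent above 1, for which the set
       is null, yet below [t]. *)
    assert (t <= (1 + t) / 2); [|lra].
    apply Ht; [lra|]; apply Hnull_gt1; [lra|]; now intros x [Hx _].
Qed.
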